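(* For all $n\ge0$, the partial derivatives with respect to the deformation variables (taken with the spectral argument held fixed and then specialised to the indicated value $\pm s$ or $\pm t$) are $$\partial_{s}\mathbf P_n(s) = \big[ \mathcal{B}^{(\infty,0)}_{n} + \xi s^{a}e^{-s} K_{n}^{0,1}(s,-s) I_3 \big]\mathbf P_n(s),$$ $$\partial_{t}\mathbf P_n(s) = \mathcal{C}^{(\infty,0)}_{n}\mathbf P_n(s) + \psi t^{b}e^{-t} K_{n}^{0,0}(s,t)\,\mathbf P^{(1)}_n(-t),$$ $$\partial_{s}\mathbf Q_n(t) = \mathcal{B}^{(\infty,\bar 0)}_{n}\mathbf Q_n(t) + \xi s^{a}e^{-s} K_{n}^{0,0}(s,t)\,\mathbf Q^{(1)}_n(-s),$$ $$\partial_{t}\mathbf Q_n(t) = \big[ \mathcal{C}^{(\infty,\bar 0)}_{n} + \psi t^{b}e^{-t} K_{n}^{1,0}(-t,t) I_3 \big]\mathbf Q_n(t),$$ $$\partial_{s}\mathbf P^{(1)}_n(-t) = \mathcal{B}^{(\infty,0)}_{n}\mathbf P^{(1)}_n(-t) + \xi s^{a}e^{-s} K_{n}^{1,1}(-t,-s)\,\mathbf P_n(s),$$ $$\partial_{t}\mathbf P^{(1)}_n(-t) = \big[ \mathcal{C}^{(\infty,0)}_{n} + \psi t^{b}e^{-t} K_{n}^{1,0}(-t,t) I_3 \big]\mathbf P^{(1)}_n(-t),$$ $$\partial_{s}\mathbf Q^{(1)}_n(-s) = \big[ \mathcal{B}^{(\infty,\bar 0)}_{n} + \xi s^{a}e^{-s}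 K_{n}^{0,1}(s,-s) I_3 \big]\mathbf Q^{(1)}_n(-s),$$ $$\partial_{t}\mathbf Q^{(1)}_n(-s) = \mathcal{C}^{(\infty,\bar 0)}_{n}\mathbf Q^{(1)}_n(-s) + \psi t^{b}e^{-t} K_{n}^{1,1}(-t,-s)\,\mathbf Q_n(t).$$
   Context: Fix $a,b,\xi,\psi\in\mathbb C$ with $\Re a,\Re b>-1$. For $s,t>0$ put $w_1(x)=(1-\xi\chi_{x>s})x^ae^{-x}$, $w_2(y)=(1-\psi\chi_{y>t})y^be^{-y}$ on $(0,\infty)$, $\langle f,g\rangle=\int_0^\infty\int_0^\infty\frac{w_1(x)w_2(y)}{x+y}f(x)g(y)\,dx\,dy$, $M_{j,k}=\langle x^j,y^k\rangle$, $Z_0=1$, $Z_n=\det(M_{j,k})_{0\le j,k\le n-1}$. $P_n,Q_n$ are polynomials of degree $n$ with the same leading coefficient $S_n$ ($S_n^2=Z_n/Z_{n+1}$, branch chosen differentiably in $(s,t)$) and $\langle P_m,Q_n\rangle=\delta_{m,n}$; objects with index $-1$ are $0$. $(s,t)$ ranges over an open set on which the standing generic conditions hold: all $M_{j,k}$ finite (absolutely convergent), $Z_n\ne0$, and $\int w_1P_n\ne0$, $\int w_2Q_n\neq0$ for all $n\ge0$. $P^{(1)}_n(z)=\int_0^\infty\frac{w_1(x)}{z-x}P_n(x)\,dx$, $Q^{(1)}_n(z)=\int_0^\infty\frac{w_2(y)}{z-y}Q_n(y)\,dy$. Vectors: $\mathbf P_n(z)=(P_{n+1}(z),P_n(z),P_{n-1}(z))^T$,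 $\mathbf P^{(1)}_n(z)=(P^{(1)}_{n+1}(z),P^{(1)}_n(z),P^{(1)}_{n-1}(z))^T$, similarly $\mathbf Q_n$, $\mathbf Q_n^{(1)}$. Kernels: $K^{0,0}_n(x,y)=\sum_{l=0}^nP_l(x)Q_l(y)$, $K^{0,1}_n=\sum_{l=0}^nP_l(x)Q^{(1)}_l(y)$, $K^{1,0}_n=\sum_{l=0}^nP^{(1)}_l(x)Q_l(y)$, $K^{1,1}_n=\sum_{l=0}^nP^{(1)}_l(x)Q^{(1)}_l(y)+\frac1{x+y}$. Matrices: $$\mathcal{B}^{(\infty,0)}_{n} = \tfrac{1}{2}\xi s^{a}e^{-s}\begin{pmatrix} P_{n+1}(s)Q^{(1)}_{n+1}(-s) & 0 & 0\\ 0 & -P_{n}(s)Q^{(1)}_{n}(-s) & 0\\ 0 & -2P_{n-1}(s)Q^{(1)}_{n}(-s) & -P_{n-1}(s)Q^{(1)}_{n-1}(-s)\end{pmatrix},$$ $\mathcal{B}^{(\infty,\bar0)}_{n}$ is the same matrix with the $(3,2)$ entry of the displayed matrix replaced by $-2P_{n}(s)Q^{(1)}_{n-1}(-s)$; $$\mathcal{C}^{(\infty,0)}_{n} = \tfrac{1}{2}\psi t^{b}e^{-t}\begin{pmatrix} P^{(1)}_{n+1}(-t)Q_{n+1}(t) & 0 & 0\\ 0 & -P^{(1)}_{n}(-t)Q_{n}(t) & 0\\ 0 & -2P^{(1)}_{n-1}(-t)Q_{n}(t) & -P^{(1)}_{n-1}(-t)Q_{n-1}(t)\end{pmatrix},$$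 $\mathcal{C}^{(\infty,\bar0)}_{n}$ is the same matrix with the $(3,2)$ entry of the displayed matrix replaced by $-2P^{(1)}_{n}(-t)Q_{n-1}(t)$. *)

(* Defs.v *)
From HB Require Import structures.
From mathcomp Require Export all_boot all_order all_algebra.
From mathcomp Require Export complex.
From mathcomp Require Export all_classical all_reals all_analysis.
Set Implicit Arguments.
Unset Strict Implicit.
Unset Printing Implicit Defensive.
Import Order.TTheory GRing.Theory Num.Theory.
Export numFieldNormedType.Exports.
Local Open Scope classical_set_scope.
Local Open Scope ring_scope.

Section ComplexCalculus.
Variable R : realType.

(* [R[i]] carries no normed-module structure over [R] in the library, hence
   integration and differentiation over [R] are taken componentwise. *)

Definition cintegrable d (T : measurableType d) (mu : {measure set T -> \bar R})
    (D : set T) (f : T -> R[i]) : Prop :=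
  mu.-integrable D (fun x => (complex.Re (f x))%:E) /\
  mu.-integrable D (fun x => (complex.Im (f x))%:E).

Definition cintegral d (T : measurableType d) (mu : {measure set T -> \bar R})
    (D : set T) (f : T -> R[i]) : R[i] :=
  Complex (Rintegral mu D (fun x => complex.Re (f x)))
          (Rintegral mu D (fun x => complex.Im (f x))).

Definition is_cderive1 (f : R -> R[i]) (x : R) (l : R[i]) : Prop :=
  is_derive x 1 (fun u => complex.Re (f u)) (complex.Re l) /\
  is_derive x 1 (fun u => complex.Im (f u)) (complex.Im l).

Definition is_vderive1 m (f : R -> 'cV[R[i]]_m) (x : R) (l : 'cV[R[i]]_m)
    : Prop :=
  forall i : 'I_m, is_cderive1 (fun u => f u i ord0) x (l i ord0).

Definition cdifferentiable (f : R -> R -> R[i]) (s t : R) : Prop :=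
  differentiable (fun p : R * R => complex.Re (f p.1 p.2)) (s, t) /\
  differentiable (fun p : R * R => complex.Im (f p.1 p.2)) (s, t).

(* The principal power x^a = exp (a * ln x), meaningful for x > 0. *)
Definition cpow (x : R) (a : R[i]) : R[i] :=
  (expR (complex.Re a * ln x))%:C%C *
  Complex (cos (complex.Im a * ln x)) (sin (complex.Im a * ln x)).

End ComplexCalculus.

Section CauchyBiorthogonal.
Variable R : realType.
Local Notation C := R[i].

Definition posR : set R := `]0, +oo[.

Definition laguerre (a : C) (x : R) : C := cpow x a * (expR (- x))%:C%C.

Definition weight (a xi : C) (s x : R) : C :=
  (1 - xi * (s < x)%R%:R) * laguerre a x.

Definition pair_integrand (w1 w2 : R -> C) (f g : {poly C}) (p : R * R) : C :=
  w1 p.1 * w2 p.2 / (p.1 + p.2)%:C%C * f.[p.1%:C%C] * g.[p.2%:C%C].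

Definition pair_integrable (w1 w2 : R -> C) (f g : {poly C}) : Prop :=
  cintegrable (lebesgue_measure \x lebesgue_measure)%E (posR `*` posR)
    (pair_integrand w1 w2 f g).

Definition pairing (w1 w2 : R -> C) (f g : {poly C}) : C :=
  cintegral (lebesgue_measure \x lebesgue_measure)%E (posR `*` posR)
    (pair_integrand w1 w2 f g).

Definition Zdet (w1 w2 : R -> C) (n : nat) : C :=
  \det (\matrix_(j < n, k < n) pairing w1 w2 'X^j 'X^k).

Definition wint (w : R -> C) (f : {poly C}) : C :=
  cintegral lebesgue_measure posR (fun x : R => w x * f.[x%:C%C]).

Definition cauchy (w : R -> C) (f : {poly C}) (z : C) : C :=
  cintegral lebesgue_measure posR
    (fun x : R => w x / (z - x%:C%C) * f.[x%:C%C]).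

(* The term of index n - 1, where objects of index -1 are 0. *)
Definition prev_term (u : nat -> C) (n : nat) : C := if n is m.+1 then u m else 0.

Definition vec3 (u : nat -> C) (n : nat) : 'cV[C]_3 :=
  \col_(i < 3) nth 0 [:: u n.+1; u n; prev_term u n] i.

Definition cd_kernel (u v : nat -> C) (n : nat) : C :=
  \sum_(0 <= l < n.+1) u l * v l.

Definition mx3 (rows : seq (seq C)) : 'M[C]_3 :=
  \matrix_(i < 3, j < 3) nth 0 (nth [::] rows i) j.

(* The common shape of the B- and C-matrices: [c] is the prefactor without
   the 1/2, [u k] (resp. [v k]) is the value of P_k or P^(1)_k (resp. Q_k or
   Q^(1)_k); [lax] is the (oo,0) version and [laxbar] the (oo,bar 0) one. *)
Definition lax (c : C) (u v : nat -> C) (n : nat) : 'M[C]_3 :=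
  (2^-1 * c) *: mx3
    [:: [:: u n.+1 * v n.+1; 0; 0];
        [:: 0; - (u n * v n); 0];
        [:: 0; - (2 * (prev_term u n * v n));
            - (prev_term u n * prev_term v n)]].

Definition laxbar (c : C) (u v : nat -> C) (n : nat) : 'M[C]_3 :=
  (2^-1 * c) *: mx3
    [:: [:: u n.+1 * v n.+1; 0; 0];
        [:: 0; - (u n * v n); 0];
        [:: 0; - (2 * (u n * prev_term v n));
            - (prev_term u n * prev_term v n)]].

End CauchyBiorthogonal.
Arguments posR {R}.

(* Main.v *)
From HB Require Import structures.
From mathcomp Require Import ring measurable_realfun.
Require Import Defs.
Import Order.TTheory GRing.Theory Num.Theory.
Set Implicit Arguments.
Unset Strict Implicit.
Unset Printing Implicit Defensive.
Local Open Scope classical_set_scope.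
Local Open Scope ring_scope.

(* Only the truncation of a weight depends on its deformation variable, so the
   fundamental theorem of calculus gives the rank-one formula
     d/ds <f, g> = - xi s^a e^(-s) f(s) g^(1)(-s).
   Differentiating <P_n, Q_l> = delta_(n,l) then determines the coordinates of
   d/ds P_n on P_0, ..., P_n: they are xi s^a e^(-s) P_n(s) Q_l^(1)(-s) for
   l < n, and half of that for l = n because P_n and Q_n share their leading
   coefficient. Applying a linear functional (evaluation or Cauchy transform,
   the latter bringing the boundary term 1/(x + y) when its weight moves) gives
   the s-equations; the t-equations follow by exchanging (w_1, P) and
   (w_2, Q). *)

(** No derivative is ever taken under an integral that contains [P n] or [Q n]. Pairings,
    evaluations and Cauchy transforms at negative points are finite combinations of coefficients and
    of their values on monomials, so the analysis concerns moments only and the rest is algebra on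
    coefficients.

    Two facts needed for this are not hypotheses. Only [S n] is assumed differentiable, so the
    derivatives of the coefficients of [P n] and [Q n] have to be produced. Only double integrals
    are assumed finite, so the moments of each single weight have to be recovered from them; they
    are what makes the Cauchy transforms converge. Fubini then turns a double moment into a single
    integral of the moving weight against a continuous function, the shape to which the fundamental
    theorem of calculus applies.

    The matrices record a mismatch of truncations: the derivative of the object of index [k]
    contains a kernel sum cut at [k], while all three rows of the statement share the kernel cut at
    [n]. *)

(** * Linear and bilinear forms on polynomials given by their moments *)

Section LinearForms.
Variable K : fieldType.
Implicit Types (mu : nat -> K) (m : nat -> nat -> K) (f g : {poly K}).

(** The functional sending ['X^i] to [mu i]. Powers of [z] give evaluation at [z], Cauchy transforms
    of monomials give the Cauchy transform. Keeping the moments as data allows them to vary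
    independently of the coefficients. *)
Definition linform mu f : K := \sum_(i < size f) f`_i * mu i.

Lemma linform_widen mu f n : (size f <= n)%N ->
  linform mu f = \sum_(i < n) f`_i * mu i.
Proof.
move=> le_fn; rewrite /linform (big_ord_widen n (fun i => f`_i * mu i)) //.
rewrite big_mkcond /=; apply: eq_bigr => i _; case: ifPn => //.
by rewrite -leqNgt => /leq_sizeP -> //; rewrite mul0r.
Qed.

Lemma linform_is_linear mu : linear (linform mu : {poly K} -> K^o).
Proof.
move=> a f g; set n := maxn (size f) (size g).
have fn : (size f <= n)%N by rewrite leq_maxl.
have gn : (size g <= n)%N by rewrite leq_maxr.
have sn : (size (a *: f + g)%R <= n)%N.
  rewrite (leq_trans (size_polyD _ _)) // geq_max gn andbT.
  exact: leq_trans (size_scale_leq _ _) fn.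
rewrite (linform_widen mu fn) (linform_widen mu gn) (linform_widen mu sn).
rewrite scaler_sumr -big_split; apply: eq_bigr => i _ /=.
by rewrite coefD coefZ mulrDl -mulrA.
Qed.

HB.instance Definition _ mu :=
  GRing.isLinear.Build K {poly K} K^o _ (linform mu) (linform_is_linear mu).

Lemma linformZ mu c f : linform mu (c *: f) = c * linform mu f.
Proof. exact: linearZ. Qed.

Lemma eq_linform mu1 mu2 f : mu1 =1 mu2 -> linform mu1 f = linform mu2 f.
Proof. by move=> eq_mu; apply: eq_bigr => i _; rewrite eq_mu. Qed.

Lemma linformE_horner f z : linform (fun i => z ^+ i) f = f.[z].
Proof. by rewrite horner_coef. Qed.

Lemma linform_scale mu c f : linform (fun i => c * mu i) f = c * linform mu f.
Proof. by rewrite mulr_sumr; apply: eq_bigr => i _; rewrite mulrCA. Qed.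

(** Nested so that linearity in [f] is inherited from [linform]; facts about [g] are reached through
    [bilformC]. *)
Definition bilform m f g : K := linform (fun i => linform (m i) g) f.

Lemma bilformC m f g : bilform m f g = bilform (fun i j => m j i) g f.
Proof.
rewrite /bilform /linform; under eq_bigr do rewrite mulr_sumr.
rewrite exchange_big /=; apply: eq_bigr => j _; rewrite mulr_sumr.
by apply: eq_bigr => i _; rewrite mulrCA.
Qed.

Lemma bilform_suml m I (r : seq I) (Pr : pred I) (F : I -> {poly K}) g :
  bilform m (\sum_(i <- r | Pr i) F i) g = \sum_(i <- r | Pr i) bilform m (F i) g.
Proof. exact: linear_sum. Qed.

Lemma bilformZl m c f g : bilform m (c *: f) g = c * bilform m f g.
Proof. exact: linformZ. Qed.

Lemma bilformBl m f1 f2 g : bilform m (f1 - f2) g = bilform m f1 g - bilform m f2 g.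
Proof. exact: linearB. Qed.

Lemma bilform_rank1 c mu nu f g :
  bilform (fun i j => c * mu i * nu j) f g = c * linform mu f * linform nu g.
Proof.
transitivity (linform (fun i => c * linform nu g * mu i) f).
  by apply: eq_linform => i; rewrite linform_scale mulrAC.
by rewrite linform_scale mulrAC.
Qed.

Section Biorthonormal.
Variables (m : nat -> nat -> K) (P Q : nat -> {poly K}).
Hypothesis sizeP : forall n, size (P n) = n.+1.
Hypothesis orthPQ : forall i j, bilform m (P i) (Q j) = (i == j)%:R.

(** Since [P l] has degree exactly [l], removing leading terms one by one yields some expansion;
    pairing it with [Q l] then forces the coefficients. *)
Lemma biorth_expand n f : (size f <= n)%N ->
  f = \sum_(l < n) bilform m f (Q l) *: P l.
Proof.
move=> sf; suff [a fE] : exists a : nat -> K, f = \sum_(l < n) a l *: P l.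
  rewrite [LHS]fE; apply: eq_bigr => l _; congr (_ *: _).
  rewrite fE bilform_suml (bigD1 l) //= bilformZl orthPQ eqxx mulr1.
  rewrite big1 ?addr0 // => k kl.
  by rewrite bilformZl orthPQ (inj_eq val_inj) (negPf kl) mulr0.
elim: n f sf => [|n IHn] f sf.
  by exists (fun=> 0); rewrite big_ord0; apply/size_poly_leq0P.
have Pn0 : (P n)`_n != 0.
  have := sizeP n; case: (P n) => -[|x q] //= lq [sq].
  by rewrite -sq -last_nth in lq *.
(* This multiple of [P n] cancels the coefficient of ['X^n]. *)
have [|a fE] := IHn (f - (f`_n / (P n)`_n) *: P n).
  apply/leq_sizeP => j; rewrite leq_eqVlt => /orP[/eqP <-|nj].
    by rewrite coefB coefZ divfK // subrr.
  have Pj0 : (P n)`_j = 0 by apply: nth_default; rewrite sizeP.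
  by rewrite coefB coefZ Pj0 mulr0 subr0 nth_default // (leq_trans sf).
exists (fun l => if (l < n)%N then a l else f`_n / (P n)`_n).
rewrite big_ord_recr /= ltnn; apply/eqP; rewrite -subr_eq; apply/eqP.
by rewrite fE; apply: eq_bigr => l _; rewrite ltn_ord.
Qed.

Lemma biorth_lower n f : (size f <= n)%N -> bilform m f (Q n) = 0.
Proof.
move=> sf; rewrite (biorth_expand sf) bilform_suml big1 // => l _.
by rewrite bilformZl orthPQ ltn_eqF ?mulr0.
Qed.

End Biorthonormal.

End LinearForms.

(** * Derivatives of complex functions and polynomials in a real parameter *)

Section ComplexDerivative.
Variable R : realType.
Local Notation C := R[i].
Implicit Types (f g : R -> C) (x : R).

Lemma ReD (z w : C) : complex.Re (z + w) = complex.Re z + complex.Re w.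
Proof. by case: z w => [? ?] [? ?]. Qed.

Lemma ImD (z w : C) : complex.Im (z + w) = complex.Im z + complex.Im w.
Proof. by case: z w => [? ?] [? ?]. Qed.

Lemma ReM (z w : C) : complex.Re (z * w) =
  complex.Re z * complex.Re w - complex.Im z * complex.Im w.
Proof. by case: z w => [? ?] [? ?]. Qed.

Lemma ImM (z w : C) : complex.Im (z * w) =
  complex.Re z * complex.Im w + complex.Im z * complex.Re w.
Proof. by case: z w => [? ?] [? ?]. Qed.

Lemma ReCM (k : R) (z : C) : complex.Re (k%:C%C * z) = k * complex.Re z.
Proof. by rewrite ReM /= mul0r subr0. Qed.

Lemma ImCM (k : R) (z : C) : complex.Im (k%:C%C * z) = k * complex.Im z.
Proof. by rewrite ImM /= mul0r addr0. Qed.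

Lemma complex_ext (z w : C) :
  complex.Re z = complex.Re w -> complex.Im z = complex.Im w -> z = w.
Proof. by case: z w => [? ?] [? ?] /= -> ->. Qed.

Lemma is_cderive1_near f g x l : (\forall u \near x, f u = g u) ->
  is_cderive1 f x l -> is_cderive1 g x l.
Proof.
move=> fg [fr fi].
by split; [apply: near_eq_is_derive fr|apply: near_eq_is_derive fi];
  apply: filterS fg => u ->.
Qed.

Lemma is_cderive1_ext f g x l : f =1 g -> is_cderive1 f x l -> is_cderive1 g x l.
Proof. by move/funext=> ->. Qed.

Lemma is_cderive1_unique f x l1 l2 :
  is_cderive1 f x l1 -> is_cderive1 f x l2 -> l1 = l2.
Proof.
move=> [r1 i1] [r2 i2]; apply: complex_ext.
  by rewrite -(@derive_val _ _ _ _ _ _ _ r1) -(@derive_val _ _ _ _ _ _ _ r2).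
by rewrite -(@derive_val _ _ _ _ _ _ _ i1) -(@derive_val _ _ _ _ _ _ _ i2).
Qed.

Lemma is_cderive1_cst (k : C) x : is_cderive1 (fun=> k) x 0.
Proof. by split; exact: is_derive_cst. Qed.

Lemma is_cderive1D f g x l k : is_cderive1 f x l -> is_cderive1 g x k ->
  is_cderive1 (fun u => f u + g u) x (l + k).
Proof.
move=> [fr fi] [gr gi]; split.
  rewrite ReD; under eq_fun do rewrite ReD; exact: is_deriveD.
rewrite ImD; under eq_fun do rewrite ImD; exact: is_deriveD.
Qed.

Lemma is_cderive1M f g x l k : is_cderive1 f x l -> is_cderive1 g x k ->
  is_cderive1 (fun u => f u * g u) x (l * g x + f x * k).
Proof.
move=> [fr fi] [gr gi]; split.
  under eq_fun do rewrite ReM.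
  have := is_deriveB (is_deriveM fr gr) (is_deriveM fi gi).
  congr is_derive; rewrite ReD !ReM /GRing.scale /=; ring.
under eq_fun do rewrite ImM.
have := is_deriveD (is_deriveM fr gi) (is_deriveM fi gr).
congr is_derive; rewrite ImD !ImM /GRing.scale /=; ring.
Qed.

Lemma is_cderive1Z (a : C) f x l : is_cderive1 f x l ->
  is_cderive1 (fun u => a * f u) x (a * l).
Proof.
by move=> /(is_cderive1M (is_cderive1_cst a x)); rewrite mul0r add0r.
Qed.

Lemma is_cderive1_sum n (F : nat -> R -> C) x (dF : nat -> C) :
  (forall i, (i < n)%N -> is_cderive1 (F i) x (dF i)) ->
  is_cderive1 (fun u => \sum_(i < n) F i u) x (\sum_(i < n) dF i).
Proof.
elim: n => [|n IHn] dFn.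
  rewrite big_ord0; apply: is_cderive1_ext (is_cderive1_cst 0 x) => u.
  by rewrite big_ord0.
rewrite big_ord_recr /=.
apply: is_cderive1_ext (is_cderive1D (IHn _) (dFn n _)) => // [u|i ltin].
  by rewrite big_ord_recr.
by apply: dFn; rewrite ltnS ltnW.
Qed.

(** Being coefficientwise, this puts no common bound on the degrees near [x]; lemmas that need a
    finite sum assume one separately. *)
Definition is_pderive1 (p : R -> {poly C}) x (dp : {poly C}) :=
  forall i, is_cderive1 (fun u => (p u)`_i) x dp`_i.

Implicit Types (p q : R -> {poly C}).

Lemma is_pderive1_near p q x dp : (\forall u \near x, p u = q u) ->
  is_pderive1 p x dp -> is_pderive1 q x dp.
Proof.
by move=> pq Dp i; apply: is_cderive1_near (Dp i); apply: filterS pq => u ->.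
Qed.

Lemma is_pderive1_cst (f : {poly C}) x : is_pderive1 (fun=> f) x 0.
Proof. by move=> i; rewrite coef0; exact: is_cderive1_cst. Qed.

Lemma is_pderive1D p q x dp dq : is_pderive1 p x dp -> is_pderive1 q x dq ->
  is_pderive1 (fun u => p u + q u) x (dp + dq).
Proof.
move=> Dp Dq i; rewrite coefD.
by apply: is_cderive1_ext (is_cderive1D (Dp i) (Dq i)) => u; rewrite coefD.
Qed.

Lemma is_pderive1Z f p x l dp : is_cderive1 f x l -> is_pderive1 p x dp ->
  is_pderive1 (fun u => f u *: p u) x (l *: p x + f x *: dp).
Proof.
move=> Df Dp i; rewrite coefD !coefZ.
by apply: is_cderive1_ext (is_cderive1M Df (Dp i)) => u; rewrite coefZ.
Qed.

Lemma is_pderive1_sum n (F : nat -> R -> {poly C}) x (dF : nat -> {poly C}) :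
  (forall i, (i < n)%N -> is_pderive1 (F i) x (dF i)) ->
  is_pderive1 (fun u => \sum_(i < n) F i u) x (\sum_(i < n) dF i).
Proof.
move=> DF i; rewrite coef_sum.
apply: is_cderive1_ext (is_cderive1_sum (fun j ltjn => DF j ltjn i)) => u.
by rewrite coef_sum.
Qed.

(** Coefficients of index at least [n] vanish identically near [x], so uniqueness of derivatives
    kills those of [dp]. *)
Lemma size_pderive1 p x dp n : is_pderive1 p x dp ->
  (\forall u \near x, (size (p u) <= n)%N) -> (size dp <= n)%N.
Proof.
move=> Dp sp; apply/leq_sizeP => j nj.
apply: (is_cderive1_unique (Dp j)).
apply: is_cderive1_near (is_cderive1_cst 0 x).
by apply: filterS sp => u /leq_sizeP ->.
Qed.

(** The product rule on a finite sum. Its range is first widened to the fixed [n], because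
    [size (p u)] may vary with [u]. *)
Lemma is_cderive1_linform (mu : R -> nat -> C) dmu p x dp n :
  (forall i, is_cderive1 (mu ^~ i) x (dmu i)) -> is_pderive1 p x dp ->
  (\forall u \near x, (size (p u) <= n)%N) ->
  is_cderive1 (fun u => linform (mu u) (p u)) x
    (linform (mu x) dp + linform dmu (p x)).
Proof.
move=> Dmu Dp sp; have sdp := size_pderive1 Dp sp.
have spx : (size (p x) <= n)%N by exact: nbhs_singleton sp.
have : is_cderive1 (fun u => \sum_(i < n) (p u)`_i * mu u i) x
    (\sum_(i < n) (dp`_i * mu x i + (p x)`_i * dmu i)).
  apply: (is_cderive1_sum (F := fun i u => (p u)`_i * mu u i)
    (dF := fun i => dp`_i * mu x i + (p x)`_i * dmu i)) => i _.
  exact: is_cderive1M.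
rewrite big_split -(linform_widen _ sdp) -(linform_widen _ spx).
apply: is_cderive1_near; apply: filterS sp => u spu.
by rewrite (linform_widen _ spu).
Qed.

(** The preceding lemma applied twice: the inner functional, acting on [q], supplies the varying
    moments of the outer one. *)
Lemma is_cderive1_bilform (m : R -> nat -> nat -> C) dm p q x dp dq n k :
  (forall i j, is_cderive1 (fun u => m u i j) x (dm i j)) ->
  is_pderive1 p x dp -> (\forall u \near x, (size (p u) <= n)%N) ->
  is_pderive1 q x dq -> (\forall u \near x, (size (q u) <= k)%N) ->
  is_cderive1 (fun u => bilform (m u) (p u) (q u)) x
    (bilform (m x) dp (q x) + bilform (m x) (p x) dq + bilform dm (p x) (q x)).
Proof.
move=> Dm Dp sp Dq sq.
have := is_cderive1_linform (fun i => is_cderive1_linform (Dm i) Dq sq) Dp sp.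
congr is_cderive1; rewrite -addrA; congr (_ + _).
by rewrite /bilform /linform -big_split; apply: eq_bigr => i _; rewrite mulrDr.
Qed.

End ComplexDerivative.

(** * Differentiability and evolution of biorthonormal families *)

Section BiorthonormalFlow.
Variable R : realType.
Local Notation C := R[i].

Definition biorthonormal (m : nat -> nat -> C) (S : nat -> C)
    (P Q : nat -> {poly C}) : Prop :=
  [/\ forall n, size (P n) = n.+1 /\ lead_coef (P n) = S n,
      forall n, size (Q n) = n.+1 /\ lead_coef (Q n) = S n &
      forall i j, bilform m (P i) (Q j) = (i == j)%:R].

Lemma biorthonormalC m S P Q : biorthonormal m S P Q ->
  biorthonormal (fun i j => m j i) S Q P.
Proof.
move=> [hP hQ hPQ]; split=> // i j.
by rewrite bilformC hPQ eq_sym.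
Qed.

(* Gram-Schmidt: since [P_k - S_k X^k] has degree [< k], it is expanded on
   [P_0, ..., P_(k-1)]; this makes differentiability inductive in [k]. *)
Lemma biorthonormal_rec m S P Q k : biorthonormal m S P Q ->
  P k = S k *: ('X^k + \sum_(l < k) - bilform m 'X^k (Q l) *: P l).
Proof.
move=> [hP hQ hPQ].
have sP n : size (P n) = n.+1 by case: (hP n).
have Pk : (P k)`_k = S k by case: (hP k) => s <-; rewrite lead_coefE s.
have sk : (size (P k - S k *: 'X^k)%R <= k)%N.
  apply/leq_sizeP => j; rewrite leq_eqVlt => /orP[/eqP <-|kj].
    by rewrite coefB coefZ coefXn eqxx mulr1 Pk subrr.
  by rewrite coefB coefZ coefXn gtn_eqF // mulr0 subr0 nth_default ?sP.
rewrite scalerDr -[LHS](subrK (S k *: 'X^k)) addrC; congr (_ + _).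
rewrite [LHS](biorth_expand sP hPQ sk) scaler_sumr; apply: eq_bigr => l _.
rewrite bilformBl hPQ gtn_eqF // sub0r bilformZl scalerA.
by rewrite mulrN.
Qed.

Variables (m : R -> nat -> nat -> C) (dm : nat -> nat -> C) (x : R).
Variables (S : nat -> R -> C) (dS : nat -> C) (P Q : nat -> R -> {poly C}).
Hypothesis Dm : forall i j, is_cderive1 (fun u => m u i j) x (dm i j).
Hypothesis DS : forall n, is_cderive1 (S n) x (dS n).
Hypothesis bPQ : \forall u \near x,
  biorthonormal (m u) (S^~ u) (P^~ u) (Q^~ u).

(** [P] and [Q] go through the induction together, since the recursion for [P k] involves [Q l] with
    [l < k], and conversely. *)
Lemma biorthonormal_pderivable k :
  (exists dp, is_pderive1 (P k) x dp) /\ (exists dq, is_pderive1 (Q k) x dq).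
Proof.
(* Stated for arbitrary families so that it serves [(m, P, Q)] and then the transposed
   [(m, Q, P)]. *)
have aux (M : R -> nat -> nat -> C) dM (A B : nat -> R -> {poly C}) n :
    (forall i j, is_cderive1 (fun u => M u i j) x (dM i j)) ->
    (\forall u \near x, biorthonormal (M u) (S^~ u) (A^~ u) (B^~ u)) ->
    (forall l, (l < n)%N -> (exists d, is_pderive1 (A l) x d) /\
                            (exists d, is_pderive1 (B l) x d)) ->
    exists d, is_pderive1 (A n) x d.
  move=> DM bAB IH.
  (* [choice] needs a pair for every [l]; [(0, 0)] is a filler for [l >= n]. *)
  have {}IH l : exists d : {poly C} * {poly C}, (l < n)%N ->
      is_pderive1 (A l) x d.1 /\ is_pderive1 (B l) x d.2.
    have [/IH[[da Da] [db Db]]|] := ltnP l n; first by exists (da, db).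
    by exists (0, 0).
  have [d Dd] := choice IH.
  (* The product rule for one Gram-Schmidt term; the inner [0] is the derivative of the constant
     ['X^n]. *)
  pose dF l : {poly C} :=
    - (bilform (M x) 0 (B l x) + bilform (M x) 'X^n (d l).2
       + bilform dM 'X^n (B l x)) *: A l x
    + - bilform (M x) 'X^n (B l x) *: (d l).1.
  exists (dS n *: ('X^n + \sum_(l < n) - bilform (M x) 'X^n (B l x) *: A l x)
          + S n x *: (0 + \sum_(l < n) dF l)).
  apply: (is_pderive1_near
    (p := fun u => S n u *: ('X^n + \sum_(l < n)
                    - bilform (M u) 'X^n (B l u) *: A l u))).
    by apply: filterS bAB => u bu; rewrite -(biorthonormal_rec _ bu).
  apply: is_pderive1Z => //; apply: is_pderive1D; first exact: is_pderive1_cst.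
  apply: (is_pderive1_sum (dF := dF)
    (F := fun l u => - bilform (M u) 'X^n (B l u) *: A l u)) => l ltln.
  have [DA DB] := Dd l ltln.
  apply: (is_pderive1Z (f := fun u => - bilform (M u) 'X^n (B l u))) => //.
  rewrite -mulN1r.
  apply: (@is_cderive1_ext _ (fun u => -1 * bilform (M u) 'X^n (B l u))).
    by move=> u; rewrite mulN1r.
  apply: is_cderive1Z.
  apply: (is_cderive1_bilform (n := n.+1) (k := l.+1)) => //.
  - exact: is_pderive1_cst.
  - by apply: filterE => u; rewrite size_polyXn.
  - by apply: filterS bAB => u [_ + _] => /(_ l)[-> _].
elim/ltn_ind: k => k IH; split; first exact: (aux m dm P Q).
apply: (aux (fun u i j => m u j i) (fun i j => dm j i) Q P) => //.
- by apply: filterS bPQ => u; exact: biorthonormalC.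
- by move=> l /IH[].
Qed.

End BiorthonormalFlow.

Section RankOneFlow.
Variable R : realType.
Local Notation C := R[i].

(** Written as the full sum up to [n] minus half of its last term, so that applying a functional to
    it exhibits the kernel sum cut at [n]. *)
Definition rank1_flow (c : C) (mu nu : nat -> C) (P Q : nat -> {poly C}) n :=
  (c * linform mu (P n)) *:
    (\sum_(l < n.+1) linform nu (Q l) *: P l
     - (2^-1 * linform nu (Q n)) *: P n).

(** Differentiating [<P_n, Q_k> = delta] leaves an unwanted term [<P_n, Q_k'>]. For [k < n] it
    vanishes, as [Q_k'] has degree below [n]. For [k = n] it equals [<P_n', Q_n>], both being
    [S_n' / S_n], and this equality produces the factor one half. *)
Lemma is_pderive1_rank1 (m : R -> nat -> nat -> C) c mu nu x S dS
    (P Q : nat -> R -> {poly C}) n :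
  (forall i j, is_cderive1 (fun u => m u i j) x (- c * mu i * nu j)) ->
  (forall n, is_cderive1 (S n) x (dS n)) ->
  (\forall u \near x, biorthonormal (m u) (S^~ u) (P^~ u) (Q^~ u)) ->
  is_pderive1 (P n) x (rank1_flow c mu nu (P^~ x) (Q^~ x) n).
Proof.
move=> Dm DS bPQ.
have [hP hQ hPQ] := nbhs_singleton bPQ.
have sP k : size (P k x) = k.+1 by case: (hP k).
have sQ k : size (Q k x) = k.+1 by case: (hQ k).
have hQP i j : bilform (fun a b => m x b a) (Q i x) (P j x) = (i == j)%:R.
  by rewrite bilformC hPQ eq_sym.
have nsP k : \forall u \near x, (size (P k u) <= k.+1)%N.
  by apply: filterS bPQ => u [/(_ k)[->]].
have nsQ k : \forall u \near x, (size (Q k u) <= k.+1)%N.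
  by apply: filterS bPQ => u [_ /(_ k)[->]].
have [[dp Dp] [dq Dq]] := biorthonormal_pderivable Dm DS bPQ n.
have sdp := size_pderive1 Dp (nsP n).
have sdq := size_pderive1 Dq (nsQ n).
have lP : (P n x)`_n = S n x by case: (hP n) => s <-; rewrite lead_coefE s.
have lQ : (Q n x)`_n = S n x by case: (hQ n) => s <-; rewrite lead_coefE s.
have S0 : S n x != 0 by case: (hP n) => s <-; rewrite lead_coef_eq0 -size_poly_eq0 s.
have dpn : dp`_n = dS n.
  apply: (is_cderive1_unique (Dp n)); apply: is_cderive1_near (DS n).
  by apply: filterS bPQ => u [/(_ n)[s <-] _ _]; rewrite lead_coefE s.
have dqn : dq`_n = dS n.
  apply: (is_cderive1_unique (Dq n)); apply: is_cderive1_near (DS n).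
  by apply: filterS bPQ => u [_ /(_ n)[s <-] _]; rewrite lead_coefE s.
(* Both derivatives have leading coefficient [dS n], so subtracting [dS n / S n x] times the
   undifferentiated polynomial lowers the degree and leaves something biorthogonality
   annihilates. *)
have sub_lead (f g : {poly C}) : (size f <= n.+1)%N -> f`_n = dS n ->
    size g = n.+1 -> g`_n = S n x ->
    (size (f - (dS n / S n x) *: g)%R <= n)%N.
  move=> sf fn sg gn; apply/leq_sizeP => j; rewrite leq_eqVlt.
  move=> /orP[/eqP <-|nj]; first by rewrite coefB coefZ fn gn divfK // subrr.
  by rewrite coefB coefZ !nth_default ?sg // ?mulr0 ?subr0 // (leq_trans sf).
have dpQ : bilform (m x) dp (Q n x) = dS n / S n x.
  have := biorth_lower sP hPQ (sub_lead _ _ sdp dpn (sP n) lP).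
  by rewrite bilformBl bilformZl hPQ eqxx mulr1 => /eqP; rewrite subr_eq0 => /eqP.
have Pdq : bilform (m x) (P n x) dq = dS n / S n x.
  rewrite bilformC; have := biorth_lower sQ hQP (sub_lead _ _ sdq dqn (sQ n) lQ).
  by rewrite bilformBl bilformZl hQP eqxx mulr1 => /eqP; rewrite subr_eq0 => /eqP.
have coefE k : (k <= n)%N -> bilform (m x) dp (Q k x) =
    c * linform mu (P n x) * linform nu (Q k x)
    - (if k == n then 2^-1 * c * linform mu (P n x) * linform nu (Q n x) else 0).
  move=> lekn; have [[_ _] [ek Dk]] := biorthonormal_pderivable Dm DS bPQ k.
  have := is_cderive1_bilform Dm Dp (nsP n) Dk (nsQ k).
  have DD : is_cderive1 (fun u => bilform (m u) (P n u) (Q k u)) x 0.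
    apply: is_cderive1_near (is_cderive1_cst (n == k)%:R x).
    by apply: filterS bPQ => u [_ _ ->].
  move=> /is_cderive1_unique/(_ DD); rewrite bilform_rank1 mulNr.
  case: eqVneq => [ekn|nkn].
    (* [ek] is a second witness for the derivative of [Q n]; uniqueness identifies it with [dq]. *)
    subst k; have -> : bilform (m x) (P n x) ek = bilform (m x) dp (Q n x).
      rewrite dpQ -Pdq; congr bilform; apply/polyP => i.
      exact: is_cderive1_unique (Dk i) (Dq i).
    (* The two equal terms combine into [2 * b = c * p * q], so the claim is checked after
       doubling. *)
    move=> E; apply: (@mulfI C 2%:R); first by rewrite pnatr_eq0.
    set b := bilform _ _ _ in E *; set p := linform mu _ in E *.
    set q := linform nu _ in E *.
    have {}E : 2 * b = c * p * q by rewrite -[RHS]addr0 -E; ring.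
    rewrite E mulrBr !mulrA mulfV ?pnatr_eq0 //; ring.
  rewrite subr0 => E.
  have ltkn : (k < n)%N by rewrite ltn_neqAle nkn.
  have P0 : bilform (m x) (P n x) ek = 0.
    rewrite bilformC (biorth_lower sQ hQP) //.
    exact: leq_trans (size_pderive1 Dk (nsQ k)) ltkn.
  by move: E; rewrite P0 addr0 mulNr => /eqP; rewrite subr_eq0 => /eqP.
rewrite (_ : rank1_flow _ _ _ _ _ _ = dp) //.
rewrite [RHS](biorth_expand sP hPQ sdp) /rank1_flow.
rewrite !big_ord_recr /= coefE // eqxx scalerBr scalerDr scaler_sumr.
rewrite -addrA; congr (_ + _); last first.
  by rewrite !scalerA -scalerBl; congr (_ *: _); ring.
apply: eq_bigr => l _; rewrite coefE 1?ltnW // ltn_eqF // subr0 scalerA.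
by [].
Qed.

End RankOneFlow.

(** * From kernel sums to the three-row matrix form *)

Section LaxForm.
Variable R : realType.
Local Notation C := R[i].
Implicit Types (u v x : nat -> C).

(** The two shapes differ only in which factor of the (3,2) entry carries the lower index. Hence a
    barred matrix is the unbarred one for the exchanged families, and only [lax] has to be
    treated. *)
Lemma laxbarC (c : C) u v n : laxbar c u v n = lax c v u n.
Proof.
rewrite /laxbar /lax; congr (_ *: _); apply/matrixP => i j; rewrite !mxE.
case: i j => [[|[|[|i]]] ?] // [[|[|[|j]]] ?] //=; ring.
Qed.

Lemma cd_kernelC u v n : cd_kernel u v n = cd_kernel v u n.
Proof. by apply: eq_bigr => l _; rewrite mulrC. Qed.

(** Each row compares [K_k] minus half its last term with the common [K_n]. Row [n + 1] has half of
    term [n + 1] in excess, row [n] lacks half of term [n], and row [n - 1] lacks all of term [n]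
    (the (3,2) entry) and half of term [n - 1]. The constant [e] leaves room for the boundary term
    of a moving functional. *)
Lemma is_vderive1_lax (X : nat -> R -> C) (c e : C) u v s n :
  (forall k, is_cderive1 (X k) s
     (c * u k * (\sum_(l < k.+1) v l * X l s - 2^-1 * v k * X k s + e))) ->
  is_vderive1 (fun t => vec3 (X^~ t) n) s
    (lax c u v n *m vec3 (X^~ s) n + (c * (cd_kernel (X^~ s) v n + e)) *: vec3 u n).
Proof.
move=> DX i.
have KE k : cd_kernel (X^~ s) v k = \sum_(l < k.+1) v l * X l s.
  by rewrite /cd_kernel big_mkord; apply: eq_bigr => l _; rewrite mulrC.
rewrite !mxE !big_ord_recl big_ord0 KE !mxE.
case: i => [[|[|[|//]]] lti] /=.
- apply: is_cderive1_ext (_ : is_cderive1 (X n.+1) _ _) => [t|]; first by rewrite mxE.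
  have := DX n.+1; congr is_cderive1; rewrite big_ord_recr /=.
  set K := \sum_(l < n.+1) _.
  by field.
- apply: is_cderive1_ext (_ : is_cderive1 (X n) _ _) => [t|]; first by rewrite mxE.
  have := DX n; congr is_cderive1.
  set K := \sum_(l < n.+1) _.
  by field.
apply: (@is_cderive1_ext _ (fun t => prev_term (X^~ t) n)) => [t|]; first by rewrite mxE.
(* For [n = 0] the third row is the object of index -1, constantly zero. *)
case: n => [|n] in lti * => /=.
  have := is_cderive1_cst (0 : C) s; congr is_cderive1; ring.
have := DX n; congr is_cderive1; rewrite [in RHS]big_ord_recr /=.
set K := \sum_(l < n.+1) _.
by field.
Qed.

End LaxForm.

(** * Complex integrals, Fubini on rectangles and exchange of variables *)

Section ComplexIntegral.
Variable R : realType.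
Local Notation C := R[i].
Context d (T : measurableType d) (mu : {measure set T -> \bar R}) (D : set T).
Hypothesis mD : measurable D.
Implicit Types (f g : T -> C) (k : C).

Lemma eq_cintegrable f g : {in D, f =1 g} ->
  cintegrable mu D f -> cintegrable mu D g.
Proof.
move=> fg [fr fi].
by split; [apply: eq_integrable fr|apply: eq_integrable fi] => // x /fg ->.
Qed.

Lemma eq_cintegral f g : {in D, f =1 g} -> cintegral mu D f = cintegral mu D g.
Proof.
by move=> fg; congr Complex; apply: eq_Rintegral => x /fg ->.
Qed.

Lemma cintegrableD f g : cintegrable mu D f -> cintegrable mu D g ->
  cintegrable mu D (fun x => f x + g x).
Proof.
move=> [fr fi] [gr gi]; split.
  by under eq_fun do rewrite ReD EFinD; exact: integrableD.
by under eq_fun do rewrite ImD EFinD; exact: integrableD.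
Qed.

Lemma cintegralD f g : cintegrable mu D f -> cintegrable mu D g ->
  cintegral mu D (fun x => f x + g x) = cintegral mu D f + cintegral mu D g.
Proof.
move=> [fr fi] [gr gi]; apply: complex_ext => /=.
  by rewrite -RintegralD //; apply: eq_Rintegral => x _; rewrite ReD.
by rewrite -RintegralD //; apply: eq_Rintegral => x _; rewrite ImD.
Qed.

Lemma cintegrableZl k f : cintegrable mu D f ->
  cintegrable mu D (fun x => k * f x).
Proof.
move=> [fr fi]; split.
  have := integrableB mD (integrableZl mD (complex.Re k) fr)
    (integrableZl mD (complex.Im k) fi).
  by apply: eq_integrable => // x _; rewrite ReM.
have := integrableD mD (integrableZl mD (complex.Re k) fi)
  (integrableZl mD (complex.Im k) fr).
by apply: eq_integrable => // x _; rewrite ImM.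
Qed.

Lemma cintegralZl k f : cintegrable mu D f ->
  cintegral mu D (fun x => k * f x) = k * cintegral mu D f.
Proof.
move=> [fr fi]; have Z a (h : T -> R) : mu.-integrable D (EFin \o h) ->
    mu.-integrable D (EFin \o (fun x => a * h x)).
  by move=> /(integrableZl mD a); apply: eq_integrable.
apply: complex_ext; rewrite ?ReM ?ImM /=.
  rewrite -!RintegralZl // -RintegralB ?Z //.
  by apply: eq_Rintegral => x _; rewrite ReM.
rewrite -!RintegralZl // -RintegralD ?Z //.
by apply: eq_Rintegral => x _; rewrite ImM.
Qed.

Lemma cintegrable0 : cintegrable mu D (fun=> 0).
Proof. by split; exact: integrable0. Qed.

Lemma cintegral0 : cintegral mu D (fun=> 0) = 0.
Proof. by apply: complex_ext; rewrite /= /Rintegral integral0. Qed.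

Lemma cintegrable_sum n (F : nat -> T -> C) :
  (forall i, cintegrable mu D (F i)) ->
  cintegrable mu D (fun x => \sum_(i < n) F i x).
Proof.
move=> iF; elim: n => [|n IHn].
  by apply: eq_cintegrable cintegrable0 => x _; rewrite big_ord0.
apply: eq_cintegrable (cintegrableD IHn (iF n)) => x _.
by rewrite big_ord_recr.
Qed.

Lemma cintegral_sum n (F : nat -> T -> C) :
  (forall i, cintegrable mu D (F i)) ->
  cintegral mu D (fun x => \sum_(i < n) F i x) =
  \sum_(i < n) cintegral mu D (F i).
Proof.
move=> iF; elim: n => [|n IHn].
  rewrite big_ord0 -[RHS]cintegral0.
  by apply: eq_cintegral => x _; rewrite big_ord0.
rewrite big_ord_recr /= -IHn -cintegralD //; last exact: cintegrable_sum.
by apply: eq_cintegral => x _; rewrite big_ord_recr.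
Qed.

Lemma cintegrable_bounded_mul (h : T -> R) f M : measurable_fun D h ->
  (forall x, D x -> `|h x| <= M) -> cintegrable mu D f ->
  cintegrable mu D (fun x => (h x)%:C%C * f x).
Proof.
move=> mh hM [fr fi].
have aux (g : T -> R) : mu.-integrable D (EFin \o g) ->
    mu.-integrable D (EFin \o (fun x => h x * g x)).
  move=> ig; have := @integrableMr _ _ _ mu D mD h (EFin \o g) mh _ ig.
  apply => //; exists M; split; first exact: num_real.
  by move=> y /ltW My x /hM hxM; exact: le_trans hxM My.
split; [move: (aux _ fr)|move: (aux _ fi)]; apply: eq_integrable => // x _ /=.
  by rewrite ReCM.
by rewrite ImCM.
Qed.

End ComplexIntegral.

Section FubiniOnRectangles.
Context {d1 d2 : measure_display} {R : realType}.
Context {T1 : measurableType d1} {T2 : measurableType d2}.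
Variable m1 : {sigma_finite_measure set T1 -> \bar R}.
Variable m2 : {sigma_finite_measure set T2 -> \bar R}.
Variables (D1 : set T1) (D2 : set T2).
Hypotheses (mD1 : measurable D1) (mD2 : measurable D2).
Local Notation C := R[i].
Local Notation m12 := (product_measure1 m1 m2).

Let mD12 : measurable (D1 `*` D2). Proof. exact: measurableX. Qed.

Let section_restrict (F : T1 * T2 -> \bar R) x : D1 x ->
  (fun y => (F \_ (D1 `*` D2)) (x, y)) = (fun y => F (x, y)) \_ D2.
Proof.
move=> D1x; apply/funext => y; rewrite !patchE.
by congr (if _ then _ else _); apply/idP/idP; rewrite !inE //= => -[].
Qed.

Let section_restrict0 (F : T1 * T2 -> \bar R) x : ~ D1 x ->
  (fun y => (F \_ (D1 `*` D2)) (x, y)) = cst 0%E.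
Proof.
move=> D1x; apply/funext => y; rewrite patchE ifF //.
by apply/negP; rewrite inE => -[].
Qed.

Lemma ae_integrable_section (F : T1 * T2 -> \bar R) :
  m12.-integrable (D1 `*` D2) F ->
  {ae m1, forall x, D1 x -> m2.-integrable D2 (fun y => F (x, y))}.
Proof.
move=> /(integrable_mkcond _ mD12)/ae_integrable1; apply: filterS => x /= + D1x.
by rewrite section_restrict // -integrable_mkcond.
Qed.

(** Fubini on the whole product is applied to [F] extended by zero. With a section integrable at
    every point of [D1], and not just almost every one, the inner integral is finite everywhere, so
    passing through [fine] loses nothing. *)
Lemma Fubini_rectangle (F : T1 * T2 -> R) :
  m12.-integrable (D1 `*` D2) (EFin \o F) ->
  (forall x, D1 x -> m2.-integrable D2 (fun y => (F (x, y))%:E)) ->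
  m1.-integrable D1 (fun x => (Rintegral m2 D2 (fun y => F (x, y)))%:E) /\
  Rintegral m12 (D1 `*` D2) F =
    Rintegral m1 D1 (fun x => Rintegral m2 D2 (fun y => F (x, y))).
Proof.
move=> iF iFx; have iF' := iF; move/(integrable_mkcond _ mD12) in iF'.
have E : fubini_F m2 ((EFin \o F) \_ (D1 `*` D2)) =
    (fun x => (Rintegral m2 D2 (fun y => F (x, y)))%:E) \_ D1.
  apply/funext => x; rewrite /fubini_F [RHS]patchE; case: ifPn => [|].
    rewrite inE => D1x; rewrite section_restrict // -integral_mkcond /Rintegral.
    by rewrite fineK // integrable_fin_num //; exact: iFx.
  by rewrite notin_setE => D1x; rewrite section_restrict0 // integral0.
split; first by apply/integrable_mkcond => //; rewrite -E; exact: integrable_fubini_F.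
rewrite /Rintegral; congr fine; rewrite integral_mkcond.
by rewrite -integral12_prod_meas1 // -/(fubini_F _ _) E -integral_mkcond.
Qed.

Lemma cFubini (F : T1 * T2 -> C) : cintegrable m12 (D1 `*` D2) F ->
  (forall x, D1 x -> cintegrable m2 D2 (fun y => F (x, y))) ->
  cintegrable m1 D1 (fun x => cintegral m2 D2 (fun y => F (x, y))) /\
  cintegral m12 (D1 `*` D2) F =
    cintegral m1 D1 (fun x => cintegral m2 D2 (fun y => F (x, y))).
Proof.
move=> [iFr iFi] iFx.
have [r1 r2] := Fubini_rectangle iFr (fun x D1x => (iFx x D1x).1).
have [i1 i2] := Fubini_rectangle iFi (fun x D1x => (iFx x D1x).2).
by split=> //; apply: complex_ext.
Qed.

End FubiniOnRectangles.

Section ProductSwap.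
Context {d1 d2 : measure_display} {R : realType}.
Context {T1 : measurableType d1} {T2 : measurableType d2}.
Variable m1 : {sigma_finite_measure set T1 -> \bar R}.
Variable m2 : {sigma_finite_measure set T2 -> \bar R}.
Local Notation m12 := (product_measure1 m1 m2).
Local Notation m21 := (product_measure1 m2 m1).

(** By Tonelli, integrability amounts to finiteness of the iterated integral of the absolute value
    in either order; the order chosen for the exchanged function is the opposite one for [F]. *)
Let integrable_swapT (F : T1 * T2 -> \bar R) : m12.-integrable setT F ->
  m21.-integrable setT (fun z : T2 * T1 => F (z.2, z.1)).
Proof.
move=> iF; have mF := measurable_int _ iF.
have mFs : measurable_fun setT (fun z : T2 * T1 => F (z.2, z.1)).
  exact: measurableT_comp mF (measurable_fun_pair measurable_snd measurable_fst).
apply/(integrable12ltyP _ _ mFs).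
exact/(integrable21ltyP _ _ mF).
Qed.

Let integral_swapT (F : T1 * T2 -> \bar R) : m12.-integrable setT F ->
  (\int[m21]_z F (z.2, z.1) = \int[m12]_z F z)%E.
Proof.
move=> iF; have iFs := integrable_swapT iF.
by rewrite -(integral12_prod_meas1 iFs) -(integral21_prod_meas1 iF).
Qed.

Variables (D1 : set T1) (D2 : set T2).
Hypotheses (mD1 : measurable D1) (mD2 : measurable D2).

Let restrict_swap (F : T1 * T2 -> \bar R) :
  (fun z => (F \_ (D1 `*` D2)) (z.2, z.1)) =
  (fun z : T2 * T1 => F (z.2, z.1)) \_ (D2 `*` D1).
Proof.
apply/funext => -[y x]; rewrite /= !patchE /=.
by congr (if _ then _ else _); apply/idP/idP; rewrite !inE /= => -[].
Qed.

Lemma integrable_swap (F : T1 * T2 -> \bar R) :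
  m12.-integrable (D1 `*` D2) F -> m21.-integrable (D2 `*` D1) (fun z : T2 * T1 => F (z.2, z.1)).
Proof.
move=> /(integrable_mkcond _ (measurableX mD1 mD2)) /integrable_swapT.
by rewrite restrict_swap -integrable_mkcond //; exact: measurableX.
Qed.

Lemma Rintegral_swap (F : T1 * T2 -> R) :
  m12.-integrable (D1 `*` D2) (EFin \o F) ->
  Rintegral m21 (D2 `*` D1) (fun z => F (z.2, z.1)) = Rintegral m12 (D1 `*` D2) F.
Proof.
move=> /(integrable_mkcond _ (measurableX mD1 mD2)) /integral_swapT.
rewrite -[in RHS]integral_mkcond => E; rewrite /Rintegral -E; congr fine.
by rewrite integral_mkcond -(restrict_swap (EFin \o F)).
Qed.

End ProductSwap.

(** * Differentiating an integral in its truncation point *)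

Section TruncatedIntegral.
Variable R : realType.
Local Notation C := R[i].
Local Notation mu := (@lebesgue_measure R).

Definition ccontinuous_at (h : R -> C) (x : R) : Prop :=
  continuous_at x (fun u => complex.Re (h u)) /\
  continuous_at x (fun u => complex.Im (h u)).

Lemma ccontinuousM (f g : R -> C) x : ccontinuous_at f x ->
  ccontinuous_at g x -> ccontinuous_at (fun u => f u * g u) x.
Proof.
move=> [fr fi] [gr gi]; split.
  under eq_fun do rewrite ReM.
  by apply: cvgB; apply: cvgM.
under eq_fun do rewrite ImM.
by apply: cvgD; apply: cvgM.
Qed.

Lemma ccontinuous_real (f : R -> R) x : continuous_at x f ->
  ccontinuous_at (fun u => (f u)%:C%C) x.
Proof. by move=> cf; split=> //; exact: cst_continuous. Qed.

Lemma ccontinuous_laguerre (a : C) x : 0 < x -> ccontinuous_at (laguerre a) x.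
Proof.
move=> x0.
have cln k : continuous_at x (fun u => k * ln u).
  by apply: continuousM; [exact: cst_continuous|exact: continuous_ln].
apply: ccontinuousM; last first.
  apply: ccontinuous_real; apply: continuous_comp; last exact: continuous_expR.
  exact: continuousN.
apply: ccontinuousM.
  apply: ccontinuous_real; apply: continuous_comp; last exact: continuous_expR.
  exact: cln.
split.
  apply: continuous_comp; last exact: continuous_cos; exact: cln.
apply: continuous_comp; last exact: continuous_sin; exact: cln.
Qed.

Lemma ccontinuousX j x : ccontinuous_at (fun u => u%:C%C ^+ j) x.
Proof.
under eq_fun do rewrite -rmorphXn; apply: ccontinuous_real.
exact: exprn_continuous.
Qed.

Lemma measurable_posR : measurable (posR : set (measurableTypeR R)).
Proof. exact: measurable_itv. Qed.

(** The indicator of []r, u]]. With [r > 0] it confines the moving part to a bounded interval away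
    from the origin, where continuity alone gives integrability. *)
Let window (r u x : R) : R := ((r < x) && (x <= u))%:R.

Let window_restrict r u (f : R -> R) :
  f \_ `]r, u] = (fun x => window r u x * f x).
Proof.
apply/funext => x; rewrite patchE /window mem_setE in_itv /=.
by case: ifP; rewrite ?mul1r ?mul0r.
Qed.

Let window_posR (r u : R) : 0 < r -> posR `&` `]r, u] = `]r, u]%classic.
Proof.
move=> r0; apply/setIidPr => x; rewrite /posR /= !in_itv /= andbT => /andP[rx _].
exact: lt_trans rx.
Qed.

Let window_int (r u : R) (f : R -> R) : 0 < r ->
  (forall x : R, 0 < x -> continuous_at x f) ->
  mu.-integrable `]r, u] (EFin \o f).
Proof.
move=> r0 cf; have : mu.-integrable `[r, u] (EFin \o f).
  apply: continuous_compact_integrable; first exact: segment_compact.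
  apply: continuous_in_subspaceT => x; rewrite inE /= in_itv /= => /andP[rx _].
  by apply: cf; exact: lt_le_trans rx.
apply: integrableS => //.
by move=> x /=; rewrite !in_itv /= => /andP[/ltW -> ->].
Qed.

Let window_int_posR (r u : R) (f : R -> R) : 0 < r ->
  (forall x : R, 0 < x -> continuous_at x f) ->
  mu.-integrable posR (fun x => (window r u x * f x)%:E).
Proof.
move=> r0 cf; have : mu.-integrable (posR `&` `]r, u]) (EFin \o f).
  by rewrite window_posR //; exact: window_int.
move=> iwf; have := (integrable_restrict mu (measurable_itv _)
  measurable_posR (EFin \o f)).1 iwf.
apply: eq_integrable => [|x _]; first exact: measurable_posR.
by rewrite patchE /window mem_setE in_itv /=; case: ifP; rewrite ?mul1r ?mul0r.
Qed.

Let window_Rint (r u : R) (f : R -> R) : 0 < r ->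
  Rintegral mu posR (fun x => window r u x * f x) = Rintegral mu `]r, u] f.
Proof.
by move=> r0; rewrite -window_restrict -Rintegral_mkcondr window_posR.
Qed.

Let window_derive (r s : R) (f : R -> R) : 0 < r -> r < s ->
  (forall x : R, 0 < x -> continuous_at x f) ->
  is_derive s 1 (fun u => Rintegral mu posR (fun x => window r u x * f x)) (f s).
Proof.
move=> r0 rs cf; under eq_fun do rewrite window_Rint //.
(* The fundamental theorem needs [s] strictly inside the interval of integrability; [s + 1] is an
   arbitrary point beyond it. *)
have ss : s < s + 1 by rewrite ltrDl.
have [df dfE] := continuous_FTC1 ss (window_int (s + 1) r0 cf) rs
  (cf _ (lt_trans r0 rs)).
by split=> //; rewrite -derive1E dfE.
Qed.

Let cwindow_int (r u : R) (g : R -> C) : 0 < r ->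
  (forall x : R, 0 < x -> ccontinuous_at g x) ->
  cintegrable mu posR (fun x => (window r u x)%:C%C * g x).
Proof.
move=> r0 cg; split.
  by under eq_fun do rewrite ReCM; apply: window_int_posR => // x /cg[].
by under eq_fun do rewrite ImCM; apply: window_int_posR => // x /cg[].
Qed.

Let cwindow_derive (r s : R) (g : R -> C) : 0 < r -> r < s ->
  (forall x : R, 0 < x -> ccontinuous_at g x) ->
  is_cderive1 (fun u => cintegral mu posR (fun x => (window r u x)%:C%C * g x))
    s (g s).
Proof.
move=> r0 rs cg; split=> /=.
  under eq_fun do under eq_Rintegral do rewrite ReCM.
  by apply: window_derive => // x /cg[].
under eq_fun do under eq_Rintegral do rewrite ImCM.
by apply: window_derive => // x /cg[].
Qed.

(** With [r = s / 2] and [u > r], the truncation factor at [u] is the one at [r] plus [xi] times the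
    indicator of []r, u]]. The first part does not depend on [u], and the second is an integral with
    moving upper endpoint. *)
Lemma is_cderive1_truncated (xi : C) (g : R -> C) (s : R) : 0 < s ->
  (forall x : R, 0 < x -> ccontinuous_at g x) ->
  cintegrable mu posR (fun x => (1 - xi * (s < x)%R%:R) * g x) ->
  is_cderive1 (fun u => cintegral mu posR
    (fun x => (1 - xi * (u < x)%R%:R) * g x)) s (xi * g s).
Proof.
move=> s0 cg ig; pose r := s / 2.
have r0 : 0 < r by rewrite divr_gt0.
have rs : r < s by rewrite ltr_pdivrMr // mulr2n mulrDr mulr1 ltrDl.
have split_at u x : r < u -> (1 - xi * (u < x)%R%:R) * g x =
    (1 - xi * (r < x)%R%:R) * g x + xi * ((window r u x)%:C%C * g x).
  move=> ru; rewrite /window rmorph_nat mulrA -mulrDl.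
  congr (_ * _); rewrite (ltNge u x).
  case: (leP x u) => [xu|ux]; case: (ltP r x) => [rx|xr] //=; try ring.
  by have := lt_le_trans (lt_trans ru ux) xr; rewrite ltxx.
(* Integrability is assumed for the truncation at [s]; removing the window between [r] and [s]
   transfers it to [r]. *)
have ir : cintegrable mu posR (fun x => (1 - xi * (r < x)%R%:R) * g x).
  have := cintegrableD measurable_posR ig
    (cintegrableZl measurable_posR (- xi) (cwindow_int s r0 cg)).
  apply: (eq_cintegrable measurable_posR) => x _.
  by rewrite (split_at s) // mulNr addrK.
apply: (@is_cderive1_near _ (fun u =>
    cintegral mu posR (fun x => (1 - xi * (r < x)%R%:R) * g x)
    + xi * cintegral mu posR (fun x => (window r u x)%:C%C * g x))).
  near=> u; have ru : r < u by near: u; exact: lt_nbhsr.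
  have iw := cwindow_int u r0 cg.
  rewrite -(cintegralZl measurable_posR _ iw).
  rewrite -(cintegralD measurable_posR ir (cintegrableZl measurable_posR xi iw)).
  by apply: eq_cintegral => x _; rewrite -split_at.
rewrite -[X in is_cderive1 _ _ X]add0r.
apply: is_cderive1D; first exact: is_cderive1_cst.
by apply: is_cderive1Z; exact: cwindow_derive.
Unshelve. all: by end_near. Qed.

End TruncatedIntegral.

(** * Cauchy transforms at points of the negative axis *)

Section CauchyTransform.
Variable R : realType.
Local Notation C := R[i].
Local Notation mu := (@lebesgue_measure R).
Local Notation mpos := (@measurable_posR R).

Lemma laguerre_neq0 (a : C) x : laguerre a x != 0.
Proof.
have e0 y : (expR y)%:C%C != 0 :> C by rewrite fmorph_eq0 gt_eqF ?expR_gt0.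
rewrite !mulf_neq0 //; apply/negP; rewrite eq_complex /= => /andP[/eqP c0 /eqP s0].
by have /eqP := cos2Dsin2 (complex.Im a * ln x); rewrite c0 s0 !expr0n addr0 eq_sym oner_eq0.
Qed.

Lemma posRE (x : R) : posR x = (0 < x).
Proof. by rewrite /posR /= in_itv /= andbT. Qed.

Lemma shifted_inv_bound (r x y : R) : 0 < r -> r <= x -> 0 < y ->
  `|- (x + y)^-1| <= r^-1.
Proof.
move=> r0 rx y0; have xy : 0 < x + y by rewrite addr_gt0 // (lt_le_trans r0).
rewrite normrN gtr0_norm ?invr_gt0 // lef_pV2 ?posrE //.
by rewrite (le_trans rx) // lerDl ltW.
Qed.

Lemma shifted_inv_continuous (x y : R) : 0 < x + y ->
  continuous_at y (fun u => - (x + u)^-1).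
Proof.
move=> xy; apply: cvgN; apply: cvgV; first by rewrite gt_eqF.
by apply: cvgD; [exact: cvg_cst|exact: cvg_id].
Qed.

Lemma measurable_shifted_inv (x : R) : 0 < x ->
  measurable_fun (posR : set (measurableTypeR R)) (fun y => - (x + y)^-1).
Proof.
move=> x0; apply: subspace_continuous_measurable_fun; first exact: mpos.
apply: continuous_in_subspaceT => y; rewrite inE posRE => y0.
by apply: shifted_inv_continuous; exact: addr_gt0.
Qed.

(** Dominated convergence: as long as [u] stays above [r = x / 2], the kernel is at most [r^-1], so
    [r^-1 * |h|] dominates. *)
Lemma shifted_inv_integral_continuous (h : R -> R) (x : R) :
  mu.-integrable posR (EFin \o h) -> 0 < x ->
  continuous_at x (fun u => Rintegral mu posR (fun y => - (u + y)^-1 * h y)).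
Proof.
move=> ih x0; pose r := x / 2.
have r0 : 0 < r by rewrite divr_gt0.
have rx : r < x by rewrite ltr_pdivrMr // mulr2n mulrDr mulr1 ltrDl.
have := @continuity_under_integral R _ _ mu (fun u y => - (u + y)^-1 * h y) posR
  mpos r (x + 1) _ _ (fun y => r^-1 * `|h y|).
apply => //.
- move=> u; rewrite /= in_itv /= => /andP[ru _].
  have u0 := lt_trans r0 ru.
  have := @integrableMr _ _ _ mu posR mpos _ (EFin \o h)
    (measurable_shifted_inv u0) _ ih.
  apply.
  exists u^-1; split; first exact: num_real.
  move=> b /ltW ub y; rewrite /= posRE => y0.
  exact: le_trans (shifted_inv_bound u0 (lexx _) y0) ub.
- apply: aeW => y; rewrite posRE => y0 u; rewrite inE /= in_itv /= => /andP[ru _].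
  apply: cvgM; last exact: cvg_cst.
  apply: cvgN; apply: cvgV; last by apply: cvgD; [exact: cvg_id|exact: cvg_cst].
  by rewrite gt_eqF // addr_gt0 // (lt_trans r0).
- have := integrableZl mpos r^-1 (integrable_norm ih).
  by apply: (eq_integrable mpos).
- move=> u; rewrite /= in_itv /= => /andP[ru _].
  apply: aeW => y; rewrite posRE => y0; rewrite normrM ler_wpM2r //.
  exact: shifted_inv_bound (ltW ru) y0.
- by rewrite inE /= in_itv /= rx ltrDl ltr01.
Qed.

Variable w : R -> C.
Hypothesis iw : forall k, cintegrable mu posR (fun y => w y * y%:C%C ^+ k).

(** At a negative point the kernel is a real factor, so it passes through real and imaginary parts
    and the real-variable estimates apply to each. *)
Lemma cauchy_integrandE x y k : w y / (- x%:C%C - y%:C%C) * ('X^k).[y%:C%C] =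
  (- (x + y)^-1)%:C%C * (w y * y%:C%C ^+ k).
Proof.
rewrite -opprD -rmorphD invrN -fmorphV rmorphN hornerXn.
by rewrite !mulrN !mulNr mulrA [_ * w y]mulrC.
Qed.

Lemma cauchy_integrable x k : 0 < x ->
  cintegrable mu posR
    (fun y => w y / (- x%:C%C - y%:C%C) * ('X^k).[y%:C%C]).
Proof.
move=> x0; under eq_fun do rewrite cauchy_integrandE.
apply: (@cintegrable_bounded_mul _ _ _ mu posR mpos
  (fun y => - (x + y)^-1) (fun y => w y * y%:C%C ^+ k) x^-1).
- exact: measurable_shifted_inv.
- by move=> y; rewrite posRE => y0; exact: shifted_inv_bound.
- exact: iw.
Qed.

Lemma cauchy_linform (f : {poly C}) x : 0 < x ->
  cauchy w f (- x%:C%C) = linform (fun k => cauchy w 'X^k (- x%:C%C)) f.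
Proof.
move=> x0; pose F k y := w y / (- x%:C%C - y%:C%C) * ('X^k).[y%:C%C].
have iF k : cintegrable mu posR (F k) by exact: cauchy_integrable.
transitivity (\sum_(k < size f) cintegral mu posR (fun y => f`_k * F k y)).
  rewrite -(@cintegral_sum _ _ _ mu posR mpos _ (fun k y => f`_k * F k y)); last first.
    by move=> k; apply: (cintegrableZl mpos).
  apply: eq_cintegral => y _; rewrite horner_coef mulr_sumr.
  by apply: eq_bigr => k _; rewrite /F hornerXn mulrCA.
by apply: eq_bigr => k _; rewrite (cintegralZl mpos).
Qed.

Lemma ccontinuous_cauchy k x : 0 < x ->
  ccontinuous_at (fun u => cauchy w 'X^k (- u%:C%C)) x.
Proof.
move=> x0; have [ir ii] := iw k.
rewrite /cauchy; split=> /=.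
  under eq_fun do under eq_Rintegral do rewrite cauchy_integrandE ReCM.
  exact: shifted_inv_integral_continuous.
under eq_fun do under eq_Rintegral do rewrite cauchy_integrandE ImCM.
exact: shifted_inv_integral_continuous.
Qed.

End CauchyTransform.

(** * Moments of the pairing and their derivatives *)

Section Pairing.
Variable R : realType.
Local Notation C := R[i].
Local Notation mu := (@lebesgue_measure R).
Local Notation mpos := (@measurable_posR R).
Implicit Types (w : R -> C) (f g : {poly C}).

Lemma ae_pair_section w1 w2 f g : pair_integrable w1 w2 f g ->
  {ae mu, forall x, posR x ->
    cintegrable mu posR (fun y => pair_integrand w1 w2 f g (x, y))}.
Proof.
move=> [/(ae_integrable_section mpos mpos) ar /(ae_integrable_section mpos mpos) ai].
by apply: filterS2 ar ai => x xr xi x0; split; [exact: xr|exact: xi].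
Qed.

(** If no such point existed, []0, s[] would be negligible, although its measure is [s > 0]. *)
Lemma ae_exists_itv (A : R -> Prop) (s : R) : 0 < s ->
  {ae mu, forall x, A x} -> exists2 x, 0 < x < s & A x.
Proof.
move=> s0 aeA; apply: contrapT => noA.
have : mu.-negligible `]0, s[.
  apply: negligibleS aeA => x; rewrite /= in_itv /= => xs Ax.
  by apply: noA; exists x.
move/negligibleP => /(_ (measurable_itv _)) m0.
have := lebesgue_measure_itv `]0, s[; rewrite /= lte_fin s0 oppr0 adde0.
rewrite [LHS]m0 => -[/esym/eqP].
by rewrite gt_eqF.
Qed.

(* Some [x < s], where the weight is not truncated, has integrable sections, and
   [y^k = x y^k / (x + y) + y^(k+1) / (x + y)]. *)
Lemma weight_moment (a xi : C) s w k : 0 < s ->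
  (forall j, pair_integrable (weight a xi s) w 'X^0 'X^j) ->
  cintegrable mu posR (fun y => w y * y%:C%C ^+ k).
Proof.
move=> s0 ipw.
pose A l x := posR x ->
  cintegrable mu posR (fun y => pair_integrand (weight a xi s) w 'X^0 'X^l (x, y)).
have aeA : {ae mu, forall x, A k x /\ A k.+1 x}.
  have ak := ae_pair_section (ipw k); have ak1 := ae_pair_section (ipw k.+1).
  exact: (@filterS2 _ _ (ae_filter_ringOfSetsType mu) _ _ _ _ ak ak1).
have [x /andP[x0 xs] [i1 i2]] := ae_exists_itv s0 aeA.
have w0 : weight a xi s x != 0.
  by rewrite /weight ltNge (ltW xs) mulr0 subr0 mul1r laguerre_neq0.
have px : posR x by rewrite posRE.
have := cintegrableZl mpos (weight a xi s x)^-1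
  (cintegrableD mpos (cintegrableZl mpos x%:C%C (i1 px)) (i2 px)).
apply: (eq_cintegrable mpos) => y; rewrite inE posRE => y0.
have xy0 : x%:C%C + y%:C%C != 0 :> C.
  by rewrite -rmorphD fmorph_eq0 gt_eqF // addr_gt0.
rewrite /pair_integrand /= !hornerXn expr0 exprS rmorphD /=.
by field; rewrite w0 xy0.
Qed.

Lemma pairing_bilform w1 w2 f g :
  (forall j k, pair_integrable w1 w2 'X^j 'X^k) ->
  pairing w1 w2 f g = bilform (fun j k => pairing w1 w2 'X^j 'X^k) f g.
Proof.
move=> ipw; have mpp : measurable ((posR `*` posR) :
    set (measurableTypeR R * measurableTypeR R)) by exact: (measurableX mpos mpos).
pose F j k := pair_integrand w1 w2 'X^j 'X^k.
pose G j p := \sum_(k < size g) g`_k * F j k p.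
have iF j k : cintegrable (mu \x mu)%E (posR `*` posR)
  (fun p => g`_k * F j k p) by apply: (cintegrableZl mpp); exact: ipw.
have iG j : cintegrable (mu \x mu)%E (posR `*` posR) (G j).
  exact: (@cintegrable_sum _ _ _ _ _ mpp _ (fun k p => g`_k * F j k p)).
transitivity (\sum_(j < size f) f`_j *
    cintegral (mu \x mu)%E (posR `*` posR) (G j)).
  transitivity (\sum_(j < size f)
    cintegral (mu \x mu)%E (posR `*` posR) (fun p => f`_j * G j p)).
    rewrite -(@cintegral_sum _ _ _ _ _ mpp _ (fun j p => f`_j * G j p)).
      apply: eq_cintegral => p _; rewrite /pair_integrand !horner_coef.
      rewrite -mulrA mulr_suml mulr_sumr; apply: eq_bigr => j _.
      rewrite /G !mulr_sumr; apply: eq_bigr => k _.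
      by rewrite /F /pair_integrand !hornerXn; ring.
    by move=> j; apply: (cintegrableZl mpp).
  by apply: eq_bigr => j _; rewrite (cintegralZl mpp).
apply: eq_bigr => j _; congr (_ * _).
rewrite /G (@cintegral_sum _ _ _ _ _ mpp _ (fun k p => g`_k * F j k p)) //.
by apply: eq_bigr => k _; rewrite (cintegralZl mpp) //; exact: ipw.
Qed.

Lemma pair_integrandC w1 w2 f g (p : R * R) :
  pair_integrand w1 w2 f g (p.2, p.1) = pair_integrand w2 w1 g f p.
Proof.
by rewrite /pair_integrand /= [p.2 + _]addrC; ring.
Qed.

Lemma pair_integrableC w1 w2 f g : pair_integrable w1 w2 f g ->
  pair_integrable w2 w1 g f.
Proof.
move=> [/(integrable_swap mpos mpos) ir /(integrable_swap mpos mpos) ii].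
split; [move: ir|move: ii]; apply: eq_integrable;
  try (exact: (measurableX mpos mpos)); by move=> p _; rewrite /= pair_integrandC.
Qed.

Lemma pairingC w1 w2 f g : pair_integrable w1 w2 f g ->
  pairing w2 w1 g f = pairing w1 w2 f g.
Proof.
move=> [/(Rintegral_swap mpos mpos) ir /(Rintegral_swap mpos mpos) ii].
by apply: complex_ext; rewrite /= -?ir -?ii; apply: eq_Rintegral => p _;
  rewrite /= pair_integrandC.
Qed.

Lemma is_cderive1_weight (a xi : C) (h : R -> C) (s : R) : 0 < s ->
  (forall x : R, 0 < x -> ccontinuous_at h x) ->
  cintegrable mu posR (fun x => weight a xi s x * h x) ->
  is_cderive1 (fun u => cintegral mu posR (fun x => weight a xi u x * h x)) s
    (xi * laguerre a s * h s).
Proof.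
move=> s0 ch ih; rewrite -mulrA.
have E u : (fun x => weight a xi u x * h x) =
    (fun x => (1 - xi * (u < x)%R%:R) * (laguerre a x * h x)).
  by apply/funext => x; rewrite /weight -mulrA.
rewrite E in ih; under eq_fun do rewrite E.
apply: is_cderive1_truncated ih => // x x0.
by apply: ccontinuousM; [exact: ccontinuous_laguerre|exact: ch].
Qed.

(** Since [1 / (x + y) = - 1 / (- x - y)], the inner integral is minus a Cauchy transform at [- x].
    What remains is a single integral of [w1], the weight that will move. *)
Lemma pairing_Fubini w1 w2 j k :
  (forall l, cintegrable mu posR (fun y => w2 y * y%:C%C ^+ l)) ->
  pair_integrable w1 w2 'X^j 'X^k ->
  let h x := - x%:C%C ^+ j * cauchy w2 'X^k (- x%:C%C) in
  cintegrable mu posR (fun x => w1 x * h x) /\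
  pairing w1 w2 'X^j 'X^k = cintegral mu posR (fun x => w1 x * h x).
Proof.
move=> iw2 ipw h.
have E x y : pair_integrand w1 w2 'X^j 'X^k (x, y) = w1 x * - x%:C%C ^+ j *
    (w2 y / (- x%:C%C - y%:C%C) * ('X^k).[y%:C%C]).
  rewrite /pair_integrand /= hornerXn -opprD invrN rmorphD /=; ring.
(* For fixed [x > 0] the kernel is at most [x^-1], so the finite moments of [w2] make every section
   integrable, as [cFubini] requires. *)
have isec (x : R) : posR x ->
    cintegrable mu posR (fun y => pair_integrand w1 w2 'X^j 'X^k (x, y)).
  rewrite posRE => x0; under eq_fun do rewrite E.
  by apply: (cintegrableZl mpos); exact: cauchy_integrable.
have [iI IE] := cFubini mpos mpos ipw isec.
have hE : {in posR, (fun x => cintegral mu posR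
    (fun y => pair_integrand w1 w2 'X^j 'X^k (x, y))) =1 (fun x => w1 x * h x)}.
  move=> x; rewrite inE posRE => x0; under eq_cintegral do rewrite E.
  by rewrite (cintegralZl mpos) ?mulrA //; exact: cauchy_integrable.
by split; [exact: (eq_cintegrable mpos hE)|rewrite /pairing IE; exact: eq_cintegral].
Qed.

Lemma is_cderive1_pairing (a xi : C) (s : R) w2 j k : 0 < s ->
  (forall l, cintegrable mu posR (fun y => w2 y * y%:C%C ^+ l)) ->
  (\forall u \near s, pair_integrable (weight a xi u) w2 'X^j 'X^k) ->
  is_cderive1 (fun u => pairing (weight a xi u) w2 'X^j 'X^k) s
    (- (xi * laguerre a s) * s%:C%C ^+ j * cauchy w2 'X^k (- s%:C%C)).
Proof.
move=> s0 iw2 nipw.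
pose h (x : R) := - x%:C%C ^+ j * cauchy w2 'X^k (- x%:C%C).
have ch (x : R) : 0 < x -> ccontinuous_at h x.
  move=> x0; apply: ccontinuousM; last exact: ccontinuous_cauchy.
  under eq_fun do rewrite -mulN1r.
  by apply: ccontinuousM; [split; exact: cst_continuous|exact: ccontinuousX].
rewrite (_ : _ * _ * _ = xi * laguerre a s * h s); last by rewrite /h; ring.
have := is_cderive1_weight s0 ch (pairing_Fubini iw2 (nbhs_singleton nipw)).1.
by apply: is_cderive1_near; apply: filterS nipw => u /(pairing_Fubini iw2)[].
Qed.

(** Here the weight inside the transform moves. The value of the kernel at the truncation point is
    the origin of the summand [1 / (x + y)] of [K11], taken at [(- t, - s)]. *)
Lemma is_cderive1_cauchy (a xi : C) (s t : R) j : 0 < s -> 0 < t ->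
  (forall l, cintegrable mu posR (fun y => weight a xi s y * y%:C%C ^+ l)) ->
  is_cderive1 (fun u => cauchy (weight a xi u) 'X^j (- t%:C%C)) s
    (xi * laguerre a s * s%:C%C ^+ j / (- t%:C%C - s%:C%C)).
Proof.
move=> s0 t0 iw; pose h x : C := (- (t + x)^-1)%:C%C * x%:C%C ^+ j.
have E w x : w x / (- t%:C%C - x%:C%C) * ('X^j).[x%:C%C] = w x * h x.
  by rewrite cauchy_integrandE mulrCA.
rewrite (_ : _ / _ = xi * laguerre a s * h s); last first.
  by rewrite /h -opprD -rmorphD invrN -fmorphV rmorphN /=; ring.
rewrite /cauchy; under eq_fun do under eq_cintegral do rewrite E.
apply: is_cderive1_weight => // [x x0|].
  apply: ccontinuousM; last exact: ccontinuousX.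
  by apply/ccontinuous_real/shifted_inv_continuous; rewrite addr_gt0.
have := cauchy_integrable iw j t0; apply: (eq_cintegrable mpos) => x _.
exact: E.
Qed.

End Pairing.

(* One weight moves with its truncation point [s], the other weight [w] is fixed;
   the theorem uses this for both [(w_1, P)] and [(w_2, Q)] as the moving side. *)
Section WeightFlow.
Variable R : realType.
Local Notation C := R[i].
Local Notation mu := (@lebesgue_measure R).

Lemma is_vderive1_near m (f g : R -> 'cV[C]_m) (x : R) l :
  (\forall u \near x, f u = g u) -> is_vderive1 f x l -> is_vderive1 g x l.
Proof.
move=> fg Df i; apply: is_cderive1_near (Df i).
by apply: filterS fg => u ->.
Qed.

(** [la] is the functional applied to [P]. Its drift is required to be a multiple of [al], the
    functional that already governs the motion of [P], so it merely adds [e] to the kernel; [e = 0]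
    for a fixed functional. *)
Lemma is_vderive1_rank1 (m : R -> nat -> nat -> C) c e (al be : nat -> C) x
    (S : nat -> R -> C) dS (P Q : nat -> R -> {poly C}) (la : R -> nat -> C) n :
  (forall i j, is_cderive1 (fun u => m u i j) x (- c * al i * be j)) ->
  (forall n, is_cderive1 (S n) x (dS n)) ->
  (\forall u \near x, biorthonormal (m u) (S^~ u) (P^~ u) (Q^~ u)) ->
  (forall i, is_cderive1 (la^~ i) x (c * e * al i)) ->
  let p k := linform al (P k x) in
  let q k := linform be (Q k x) in
  let X k u := linform (la u) (P k u) in
  is_vderive1 (fun u => vec3 (X^~ u) n) x
    (lax c p q n *m vec3 (X^~ x) n
     + (c * (cd_kernel (X^~ x) q n + e)) *: vec3 p n).
Proof.
move=> Dm DS bPQ Dla p q X; apply: is_vderive1_lax => k.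
have sP : \forall u \near x, (size (P k u) <= k.+1)%N.
  by apply: filterS bPQ => u [/(_ k)[->]].
have := is_cderive1_linform Dla (is_pderive1_rank1 k Dm DS bPQ) sP.
congr is_cderive1; rewrite linform_scale /rank1_flow linformZ linearB linear_sum.
rewrite /= linformZ [c * e * _]mulrAC -mulrDr; congr (_ * (_ - _ + _)).
by apply: eq_bigr => l _; rewrite linformZ.
Qed.

Variables (a xi : C) (s t : R) (w : R -> C).
Variables (S : nat -> R -> C) (dS : nat -> C) (P Q : nat -> R -> {poly C}).
Hypotheses (s0 : 0 < s) (t0 : 0 < t).
Hypothesis DS : forall n, is_cderive1 (S n) s (dS n).
Hypothesis iw : forall l, cintegrable mu posR (fun y => w y * y%:C%C ^+ l).
Hypothesis iweight : \forall u \near s, forall l,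
  cintegrable mu posR (fun y => weight a xi u y * y%:C%C ^+ l).
Hypothesis ipair : \forall u \near s, forall j k,
  pair_integrable (weight a xi u) w 'X^j 'X^k.
Hypothesis biPQ : \forall u \near s,
  [/\ forall n, size (P n u) = n.+1 /\ lead_coef (P n u) = S n u,
      forall n, size (Q n u) = n.+1 /\ lead_coef (Q n u) = S n u &
      forall i j, pairing (weight a xi u) w (P i u) (Q j u) = (i == j)%:R].

Let c := xi * laguerre a s.
Let p k := (P k s).[s%:C%C].
Let q k := cauchy w (Q k s) (- s%:C%C).
Let m u j k := pairing (weight a xi u) w 'X^j 'X^k.
Let al j : C := s%:C%C ^+ j.
Let be k := cauchy w 'X^k (- s%:C%C).

Let Dm j k : is_cderive1 (fun u => m u j k) s (- c * al j * be k).
Proof.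
by apply: is_cderive1_pairing => //; apply: filterS ipair => u; apply.
Qed.

Let bPQ : \forall u \near s, biorthonormal (m u) (S^~ u) (P^~ u) (Q^~ u).
Proof.
apply: filterS2 ipair biPQ => u ipu [hP hQ hPQ]; split=> // i j.
by rewrite -pairing_bilform.
Qed.

Let bQP : \forall u \near s,
  biorthonormal (fun j k => m u k j) (S^~ u) (Q^~ u) (P^~ u).
Proof. by apply: filterS bPQ => u; exact: biorthonormalC. Qed.

Let Dm' j k : is_cderive1 (fun u => m u k j) s (- c * be j * al k).
Proof. by rewrite mulrAC; exact: Dm. Qed.

Let pE k : linform al (P k s) = p k. Proof. exact: linformE_horner. Qed.

Let qE k : linform be (Q k s) = q k. Proof. by rewrite /q cauchy_linform. Qed.

(** [X] is represented by [la] near [s] only: for a Cauchy transform of the moving weight the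
    representation rests on finite moments at the truncation point [u]. *)
Let flowP e (la : R -> nat -> C) (X : nat -> R -> C) n :
  (forall i, is_cderive1 (la^~ i) s (c * e * al i)) ->
  (\forall u \near s, forall k, X k u = linform (la u) (P k u)) ->
  is_vderive1 (fun u => vec3 (X^~ u) n) s
    (lax c p q n *m vec3 (X^~ s) n + (c * (cd_kernel (X^~ s) q n + e)) *: vec3 p n).
Proof.
move=> Dla XE; have := is_vderive1_rank1 n Dm DS bPQ Dla => /=.
have XsE : X^~ s = fun k => linform (la s) (P k s).
  by apply/funext => k; exact: (nbhs_singleton XE).
rewrite -XsE (funext pE) (funext qE); apply: is_vderive1_near.
by apply: filterS XE => u /funext ->.
Qed.

(** The weight [w] paired with [Q] is fixed, so every functional applied to [Q] is constant in [s]
    and no boundary term occurs. *)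
Let flowQ (la : nat -> C) (X : nat -> R -> C) n :
  (\forall u \near s, forall k, X k u = linform la (Q k u)) ->
  is_vderive1 (fun u => vec3 (X^~ u) n) s
    (lax c q p n *m vec3 (X^~ s) n + (c * cd_kernel (X^~ s) p n) *: vec3 q n).
Proof.
move=> XE.
have D i : is_cderive1 (fun=> la i) s (c * 0 * be i).
  by rewrite mulr0 mul0r; exact: is_cderive1_cst.
have := @is_vderive1_rank1 _ c 0 _ _ s S dS Q P (fun=> la) n Dm' DS bQP D => /=.
have XsE : X^~ s = fun k => linform la (Q k s).
  by apply/funext => k; exact: (nbhs_singleton XE).
rewrite addr0 -XsE (funext pE) (funext qE); apply: is_vderive1_near.
by apply: filterS XE => u /funext ->.
Qed.

Lemma weight_flow_P z n : let X k u := (P k u).[z] in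
  is_vderive1 (fun u => vec3 (X^~ u) n) s
    (lax c p q n *m vec3 (X^~ s) n + (c * cd_kernel (X^~ s) q n) *: vec3 p n).
Proof.
move=> X; rewrite -[cd_kernel _ _ _]addr0.
apply: (flowP (la := fun _ i => z ^+ i)) => [i|].
  by rewrite mulr0 mul0r; exact: is_cderive1_cst.
by apply: filterE => u k; rewrite linformE_horner.
Qed.

Lemma weight_flow_Q z n : let X k u := (Q k u).[z] in
  is_vderive1 (fun u => vec3 (X^~ u) n) s
    (lax c q p n *m vec3 (X^~ s) n + (c * cd_kernel (X^~ s) p n) *: vec3 q n).
Proof.
move=> X; apply: (flowQ (la := fun i => z ^+ i)).
by apply: filterE => u k; rewrite linformE_horner.
Qed.

Lemma weight_flow_P1 n : let X k u := cauchy (weight a xi u) (P k u) (- t%:C%C) in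
  is_vderive1 (fun u => vec3 (X^~ u) n) s
    (lax c p q n *m vec3 (X^~ s) n +
     (c * (cd_kernel (X^~ s) q n + (- t%:C%C - s%:C%C)^-1)) *: vec3 p n).
Proof.
move=> X.
apply: (flowP (la := fun u i => cauchy (weight a xi u) 'X^i (- t%:C%C))) => [i|].
  by rewrite mulrAC; exact: is_cderive1_cauchy (nbhs_singleton iweight).
by apply: filterS iweight => u iwu k; exact: cauchy_linform.
Qed.

Lemma weight_flow_Q1 n : let X k u := cauchy w (Q k u) (- s%:C%C) in
  is_vderive1 (fun u => vec3 (X^~ u) n) s
    (lax c q p n *m vec3 (X^~ s) n + (c * cd_kernel (X^~ s) p n) *: vec3 q n).
Proof.
move=> X; apply: (flowQ (la := be)).
by apply: filterE => u k; exact: cauchy_linform.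
Qed.

End WeightFlow.

(** * Restriction to coordinate lines and assembly of the eight equations *)

(** Used with horizontal and vertical lines, to pass from joint differentiability of [S n] to
    derivatives in one variable. *)
Lemma cdifferentiable_along (R : realType) (F : R -> R -> R[i])
    (phi : R -> R * R) (x : R) : differentiable phi x ->
  cdifferentiable F (phi x).1 (phi x).2 ->
  exists l, is_cderive1 (fun u => F (phi u).1 (phi u).2) x l.
Proof.
move=> dphi; rewrite /cdifferentiable -surjective_pairing => -[dr di].
have along (G : R * R -> R) : differentiable G (phi x) ->
    derivable (fun u => G (phi u)) x 1.
  by move=> dG; apply/derivable1_diffP; exact: (@differentiable_comp _ _ _ _ phi G).
exists (Complex ('D_1 (fun u => complex.Re (F (phi u).1 (phi u).2)) x)
                ('D_1 (fun u => complex.Im (F (phi u).1 (phi u).2)) x)).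
by split; apply: derivableP; [exact: along dr|exact: along di].
Qed.

Lemma mulmxDscalar1 (K : comNzRingType) n (A : 'M[K]_n) k (v : 'cV[K]_n) :
  (A + k *: 1%:M) *m v = A *m v + k *: v.
Proof. by rewrite mulmxDl -scalemxAl mul1mx. Qed.

Theorem proposition4p12 (R : realType) (a b xi psi : R[i])
  (ha : -1 < complex.Re a) (hb : -1 < complex.Re b)
  (U : set (R * R)) (hU : open U)
  (hUpos : forall s t : R, U (s, t) -> 0 < s /\ 0 < t)
  (S : nat -> R -> R -> R[i]) (P Q : nat -> R -> R -> {poly R[i]})
  (hM : forall s t : R, U (s, t) -> forall j k : nat,
     pair_integrable (weight a xi s) (weight b psi t) 'X^j 'X^k)
  (hZ : forall s t : R, U (s, t) -> forall n : nat,
     Zdet (weight a xi s) (weight b psi t) n != 0)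
  (hSdiff : forall s t : R, U (s, t) -> forall n : nat,
     cdifferentiable (S n) s t)
  (hS : forall s t : R, U (s, t) -> forall n : nat,
     S n s t ^+ 2 = Zdet (weight a xi s) (weight b psi t) n
                    / Zdet (weight a xi s) (weight b psi t) n.+1)
  (hP : forall s t : R, U (s, t) -> forall n : nat,
     size (P n s t) = n.+1 /\ lead_coef (P n s t) = S n s t)
  (hQ : forall s t : R, U (s, t) -> forall n : nat,
     size (Q n s t) = n.+1 /\ lead_coef (Q n s t) = S n s t)
  (hPQ : forall s t : R, U (s, t) -> forall m n : nat,
     pairing (weight a xi s) (weight b psi t) (P m s t) (Q n s t)
     = (m == n)%:R)
  (hPint : forall s t : R, U (s, t) -> forall n : nat,
     wint (weight a xi s) (P n s t) != 0)
  (hQint : forall s t : R, U (s, t) -> forall n : nat,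
     wint (weight b psi t) (Q n s t) != 0) :
  let P0 (n : nat) (s t : R) (z : R[i]) : R[i] := (P n s t).[z] in
  let Q0 (n : nat) (s t : R) (z : R[i]) : R[i] := (Q n s t).[z] in
  let P1 (n : nat) (s t : R) (z : R[i]) : R[i] :=
    cauchy (weight a xi s) (P n s t) z in
  let Q1 (n : nat) (s t : R) (z : R[i]) : R[i] :=
    cauchy (weight b psi t) (Q n s t) z in
  let vP n s t z := vec3 (fun k : nat => P0 k s t z) n in
  let vQ n s t z := vec3 (fun k : nat => Q0 k s t z) n in
  let vP1 n s t z := vec3 (fun k : nat => P1 k s t z) n in
  let vQ1 n s t z := vec3 (fun k : nat => Q1 k s t z) n in
  let K00 n s t (x y : R[i]) :=
    cd_kernel (fun l : nat => P0 l s t x) (fun l : nat => Q0 l s t y) n in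
  let K01 n s t (x y : R[i]) :=
    cd_kernel (fun l : nat => P0 l s t x) (fun l : nat => Q1 l s t y) n in
  let K10 n s t (x y : R[i]) :=
    cd_kernel (fun l : nat => P1 l s t x) (fun l : nat => Q0 l s t y) n in
  let K11 n s t (x y : R[i]) :=
    cd_kernel (fun l : nat => P1 l s t x) (fun l : nat => Q1 l s t y) n
    + (x + y)^-1 in
  forall (n : nat) (s t : R), U (s, t) ->
  let sC : R[i] := s%:C%C in
  let tC : R[i] := t%:C%C in
  let c : R[i] := xi * laguerre a s in
  let d : R[i] := psi * laguerre b t in
  let B := lax c (fun k => P0 k s t sC) (fun k => Q1 k s t (- sC)) n in
  let Bbar := laxbar c (fun k => P0 k s t sC) (fun k => Q1 k s t (- sC)) n in
  let C := lax d (fun k => P1 k s t (- tC)) (fun k => Q0 k s t tC) n in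
  let Cbar := laxbar d (fun k => P1 k s t (- tC)) (fun k => Q0 k s t tC) n in
  [/\ is_vderive1 (fun u => vP n u t sC) s
        ((B + (c * K01 n s t sC (- sC)) *: 1%:M) *m vP n s t sC),
      is_vderive1 (fun u => vP n s u sC) t
        (C *m vP n s t sC + (d * K00 n s t sC tC) *: vP1 n s t (- tC)),
      is_vderive1 (fun u => vQ n u t tC) s
        (Bbar *m vQ n s t tC + (c * K00 n s t sC tC) *: vQ1 n s t (- sC)) &
      is_vderive1 (fun u => vQ n s u tC) t
        ((Cbar + (d * K10 n s t (- tC) tC) *: 1%:M) *m vQ n s t tC)] /\
  [/\ is_vderive1 (fun u => vP1 n u t (- tC)) s
        (B *m vP1 n s t (- tC) + (c * K11 n s t (- tC) (- sC)) *: vP n s t sC),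
      is_vderive1 (fun u => vP1 n s u (- tC)) t
        ((C + (d * K10 n s t (- tC) tC) *: 1%:M) *m vP1 n s t (- tC)),
      is_vderive1 (fun u => vQ1 n u t (- sC)) s
        ((Bbar + (c * K01 n s t sC (- sC)) *: 1%:M) *m vQ1 n s t (- sC)) &
      is_vderive1 (fun u => vQ1 n s u (- sC)) t
        (Cbar *m vQ1 n s t (- sC)
         + (d * K11 n s t (- tC) (- sC)) *: vQ n s t tC)].
Proof.
move=> P0 Q0 P1 Q1 vP vQ vP1 vQ1 K00 K01 K10 K11 n s t Ust sC tC c d B Bbar Ct Cbar.
have [s0 t0] := hUpos s t Ust.
have nU : nbhs (s, t) U by exact: open_nbhs_nbhs.
have Us : \forall u \near s, U (u, t).
  by apply: (cvg_pair (@cvg_id _ (nbhs s)) (cvg_cst t) nU).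
have Ut : \forall u \near t, U (s, u).
  by apply: (cvg_pair (cvg_cst s) (@cvg_id _ (nbhs t)) nU).
have ds : differentiable (fun u : R => (u, t)) s by exact: differentiable_pair.
have dt : differentiable (fun u : R => (s, u)) t by exact: differentiable_pair.
have [dSs DSs] := choice (fun k => @cdifferentiable_along _ (S k)
  (fun u => (u, t)) s ds (hSdiff s t Ust k)).
have [dSt DSt] := choice (fun k => @cdifferentiable_along _ (S k)
  (fun u => (s, u)) t dt (hSdiff s t Ust k)).
have mom2 u v : U (u, v) -> forall l, cintegrable (@lebesgue_measure R) posR
    (fun y => weight b psi v y * y%:C%C ^+ l).
  move=> Uuv l; apply: (@weight_moment _ a xi u (weight b psi v) l (hUpos u v Uuv).1) => j.
  exact: hM.
have mom1 u v : U (u, v) -> forall l, cintegrable (@lebesgue_measure R) posR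
    (fun x => weight a xi u x * x%:C%C ^+ l).
  move=> Uuv l; apply: (@weight_moment _ b psi v (weight a xi u) l (hUpos u v Uuv).2) => j.
  by apply: pair_integrableC; exact: hM.
have pairC u v i j : U (u, v) ->
    pairing (weight b psi v) (weight a xi u) (Q i u v) (P j u v) = (i == j)%:R.
  move=> Uuv; rewrite pairing_bilform; last first.
    by move=> *; apply: pair_integrableC; exact: hM.
  rewrite bilformC eq_sym -(hPQ u v Uuv) pairing_bilform; last exact: hM.
  by apply: eq_linform => k; apply: eq_linform => l; apply: pairingC; exact: hM.
have ms : \forall u \near s, forall l, cintegrable (@lebesgue_measure R) posR
    (fun x => weight a xi u x * x%:C%C ^+ l).
  by apply: filterS Us => u; exact: mom1.
have mt : \forall u \near t, forall l, cintegrable (@lebesgue_measure R) posR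
    (fun x => weight b psi u x * x%:C%C ^+ l).
  by apply: filterS Ut => u; exact: mom2.
have ps : \forall u \near s, forall j k,
    pair_integrable (weight a xi u) (weight b psi t) 'X^j 'X^k.
  by apply: filterS Us => u; exact: hM.
have pt : \forall u \near t, forall j k,
    pair_integrable (weight b psi u) (weight a xi s) 'X^j 'X^k.
  by apply: filterS Ut => u Usu j k; apply: pair_integrableC; exact: hM.
have bs : \forall u \near s,
    [/\ forall k, size (P k u t) = k.+1 /\ lead_coef (P k u t) = S k u t,
        forall k, size (Q k u t) = k.+1 /\ lead_coef (Q k u t) = S k u t &
        forall i j, pairing (weight a xi u) (weight b psi t) (P i u t) (Q j u t)
                    = (i == j)%:R].
  by apply: filterS Us => u Uut; split; [exact: hP|exact: hQ|exact: hPQ].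
have bt : \forall u \near t,
    [/\ forall k, size (Q k s u) = k.+1 /\ lead_coef (Q k s u) = S k s u,
        forall k, size (P k s u) = k.+1 /\ lead_coef (P k s u) = S k s u &
        forall i j, pairing (weight b psi u) (weight a xi s) (Q i s u) (P j s u)
                    = (i == j)%:R].
  by apply: filterS Ut => u Usu; split; [exact: hQ|exact: hP|move=> *; exact: pairC].
have m1 := mom1 s t Ust; have m2 := mom2 s t Ust.
pose S2 k u := S k s u; pose Ps k u := P k u t; pose Qs k u := Q k u t.
pose S1 k u := S k u t; pose Pt k u := P k s u; pose Qt k u := Q k s u.
(* In the four equations with an [I_3] term, the spectral point is the one tied to the moving
   variable, so the vector multiplied by the kernel is the differentiated vector itself and the
   scalar matrix can be expanded. The remaining kernel rewrites only reorder the factors, as the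
   flow lemmas list the differentiated family first. *)
rewrite /Bbar /Cbar !laxbarC !mulmxDscalar1; split; split.
- exact: (weight_flow_P (S := S1) (P := Ps) (Q := Qs) s0 DSs m2 ps bs).
- rewrite /Ct /K00.
  exact: (weight_flow_Q (S := S2) (P := Qt) (Q := Pt) t0 DSt m1 pt bt).
- rewrite /K00 cd_kernelC.
  exact: (weight_flow_Q (S := S1) (P := Ps) (Q := Qs) s0 DSs m2 ps bs).
- rewrite /K10 cd_kernelC.
  exact: (weight_flow_P (S := S2) (P := Qt) (Q := Pt) t0 DSt m1 pt bt).
- exact: (weight_flow_P1 (S := S1) (P := Ps) (Q := Qs) s0 t0 DSs m2 ms ps bs).
- rewrite /K10.
  exact: (weight_flow_Q1 (S := S2) (P := Qt) (Q := Pt) t0 DSt m1 pt bt).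
- rewrite /K01 cd_kernelC.
  exact: (weight_flow_Q1 (S := S1) (P := Ps) (Q := Qs) s0 DSs m2 ps bs).
rewrite /K11 cd_kernelC [- tC - sC]addrC.
exact: (weight_flow_P1 (S := S2) (P := Qt) (Q := Pt) t0 s0 DSt m1 mt pt bt).
Qed.
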